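(* Let $N$ be a positive integer and let $H^2_{\beta}$ be a weighted Hardy space of $N$-polynomial growth. If $\varphi$ is a hyperbolic disk automorphism, then the spectrum of $C_{\varphi}$ acting on $H^2_{\beta}$ is contained in an annulus; more precisely, $$\sigma(C_{\varphi})\subseteq \left\{z\in \mathbb{C};\ \left(\frac{1-|\varphi(0)|}{1+|\varphi(0)|}\right)^{2N^2+3N+2} \leq|z|\leq \left(\frac{1+|\varphi(0)|}{1-|\varphi(0)|}\right)^{2N^2+3N+2} \right\}.$$
   Context: $\mathbb{D}$ is the open unit disk. Let $w=\{w_k\}_{k\ge1}$ be a sequence of positive numbers with $w_k\to1$, and put $\beta_0=1$, $\beta_k=\prod_{j=1}^k w_j$. The weighted Hardy space $H^2_\beta$ is the Hilbert space of analytic functions $f(z)=\sum_{k\ge0}\widehat f(k)z^k$ on $\mathbb{D}$ with $\|f\|_{H^2_\beta}^2=\sum_{k\ge0}|\widehat f(k)|^2\beta_k^2<\infty$. It is said to be of $N$-polynomial growth if $\frac{k+1}{k+N+1}\le w_k\le\frac{k+N+1}{k+1}$ for all $k\ge1$. A disk automorphism is an analytic bijection $\mathbb{D}\to\mathbb{D}$, i.e. a map $z\mapsto e^{i\theta}\frac{z_0-z}{1-\overline{z_0}z}$ with $z_0\in\mathbb{D}$; it is hyperbolic if it has two distinct fixed points on the unit circle. $C_\varphi f=f\circ\varphi$. *)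

(* Defs.v *)
(* Stdlib reals with Coquelicot's complex numbers [C], viewed as a normed module
   over [C_AbsRing]. *)
From Stdlib Require Import Reals Lra Lia Psatz.
From Stdlib Require Import FunctionalExtensionality ProofIrrelevance.
From Coquelicot Require Import Coquelicot.
Open Scope R_scope.

(** * Weights *)

(* The weight w_1, w_2, ... is indexed from 1: the value at 0 is never used. *)
Record weight := Weight {
  weight_seq :> nat -> R;
  weight_pos : forall k, (1 <= k)%nat -> 0 < weight_seq k;
  weight_lim : is_lim_seq weight_seq 1
}.

Fixpoint beta (w : nat -> R) (k : nat) : R :=
  match k with
  | O => 1
  | S j => beta w j * w (S j)
  end.

Definition polynomial_growth (N : nat) (w : nat -> R) : Prop :=
  forall k, (1 <= k)%nat ->
    (INR k + 1) / (INR k + INR N + 1) <= w k <= (INR k + INR N + 1) / (INR k + 1).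

(** * The unit disk and its automorphisms *)

Definition disk := {z : C | Cmod z < 1}.

Definition disk_val (z : disk) : C := proj1_sig z.

Lemma disk_center_proof : Cmod 0 < 1.
Proof. rewrite Cmod_0; lra. Qed.

Definition disk_center : disk := exist _ (RtoC 0) disk_center_proof.

(* e^(i theta) is written (cos theta, sin theta). *)
Definition moebius (theta : R) (z0 z : C) : C :=
  (((cos theta, sin theta) : C) * ((z0 - z) / (1 - Cconj z0 * z)))%C.

(* The fixed points on the unit circle are those of the extension of phi to the
   closed disk given by the same formula. *)
Definition hyperbolic_automorphism (phi : disk -> disk) : Prop :=
  exists (theta : R) (z0 : C),
    Cmod z0 < 1 /\
    (forall z : disk, disk_val (phi z) = moebius theta z0 (disk_val z)) /\
    exists zeta1 zeta2 : C,
      zeta1 <> zeta2 /\ Cmod zeta1 = 1 /\ Cmod zeta2 = 1 /\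
      moebius theta z0 zeta1 = zeta1 /\ moebius theta z0 zeta2 = zeta2.

(** * The weighted Hardy space *)

Section WeightedHardySpace.

Variable w : weight.

Definition coef_terms (a : nat -> C) (k : nat) : R :=
  Cmod (a k) ^ 2 * beta w k ^ 2.

(* An analytic function on the disk together with its Taylor coefficients at 0;
   each of [hardy_fun] and [hardy_coef] determines the other. *)
Record hardy := Hardy {
  hardy_fun : disk -> C;
  hardy_coef : nat -> C;
  hardy_taylor : forall z : disk,
    is_pseries (V := C_NormedModule) hardy_coef (disk_val z) (hardy_fun z);
  hardy_summable : ex_series (coef_terms hardy_coef)
}.

Definition hardy_norm (f : hardy) : R := sqrt (Series (coef_terms (hardy_coef f))).

Lemma beta_pos k : 0 < beta w k.
Proof.
induction k as [|k IH]; simpl; [lra|].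
apply Rmult_lt_0_compat; [exact IH|apply weight_pos; lia].
Qed.

Lemma coef_terms_ge0 a k : 0 <= coef_terms a k.
Proof. unfold coef_terms; apply Rmult_le_pos; apply pow2_ge_0. Qed.

Lemma hardy_eq (f g : hardy) :
  (forall k, hardy_coef f k = hardy_coef g k) -> f = g.
Proof.
destruct f as [f a fa sa], g as [g b gb sb]; simpl; intros H.
apply functional_extensionality in H; subst b.
assert (E : f = g).
{ apply functional_extensionality; intros z.
  exact (filterlim_locally_unique _ _ _ (fa z) (gb z)). }
subst g; f_equal; apply proof_irrelevance.
Qed.

Lemma series_pos_eq0 (u : nat -> R) :
  (forall k, 0 <= u k) -> ex_series u -> Series u = 0 -> forall k, u k = 0.
Proof.
intros Hu Ex S0 k.
assert (H : sum_n u k <= 0).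
{ rewrite <- S0.
  apply (is_lim_seq_incr_compare (sum_n u)).
  - exact (Series_correct _ Ex).
  - intros n; rewrite sum_Sn; unfold plus; simpl; specialize (Hu (S n)); lra. }
assert (G : forall n, 0 <= sum_n u n).
{ induction n; [rewrite sum_O; apply Hu|].
  rewrite sum_Sn; unfold plus; simpl; specialize (Hu (S n)); lra. }
destruct k; [rewrite sum_O in H; specialize (Hu 0%nat); lra|].
rewrite sum_Sn in H; unfold plus in H; simpl in H.
specialize (G k); specialize (Hu (S k)); lra.
Qed.

Lemma Series_ge0 (u : nat -> R) :
  (forall k, 0 <= u k) -> ex_series u -> 0 <= Series u.
Proof.
intros Hu Ex.
replace 0 with (Series (fun k => 0 * u k)) by (rewrite Series_scal_l; ring).
apply Series_le; [|exact Ex].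
intros k; specialize (Hu k); lra.
Qed.

Lemma sum_sqr_le (x y t : R) : 0 < t ->
  (x + y) ^ 2 <= (1 + t) * x ^ 2 + (1 + / t) * y ^ 2.
Proof.
intros Ht.
assert (E : (1 + t) * x ^ 2 + (1 + / t) * y ^ 2 - (x + y) ^ 2
            = / t * (t * x - y) ^ 2) by (field; lra).
assert (0 <= / t * (t * x - y) ^ 2).
{ apply Rmult_le_pos; [left; apply Rinv_0_lt_compat; exact Ht|apply pow2_ge_0]. }
lra.
Qed.

Lemma coef_terms_plus_le a b t k : 0 < t ->
  coef_terms (fun n => (a n + b n)%C) k
    <= (1 + t) * coef_terms a k + (1 + / t) * coef_terms b k.
Proof.
intros Ht; unfold coef_terms.
apply Rle_trans with ((Cmod (a k) + Cmod (b k)) ^ 2 * beta w k ^ 2).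
- apply Rmult_le_compat_r; [apply pow2_ge_0|].
  apply pow_incr; split; [apply Cmod_ge_0|apply Cmod_triangle].
- replace ((1 + t) * (Cmod (a k) ^ 2 * beta w k ^ 2)
           + (1 + / t) * (Cmod (b k) ^ 2 * beta w k ^ 2))
    with (((1 + t) * Cmod (a k) ^ 2 + (1 + / t) * Cmod (b k) ^ 2) * beta w k ^ 2)
    by ring.
  apply Rmult_le_compat_r; [apply pow2_ge_0|].
  apply sum_sqr_le; exact Ht.
Qed.

Lemma ex_series_comb (u v : nat -> R) (p q : R) : ex_series u -> ex_series v ->
  ex_series (fun k => p * u k + q * v k).
Proof.
intros Hu Hv.
apply (ex_series_plus (fun k => p * u k) (fun k => q * v k)).
- exact (ex_series_scal_l p u Hu).
- exact (ex_series_scal_l q v Hv).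
Qed.

Lemma ex_coef_terms_plus a b : ex_series (coef_terms a) ->
  ex_series (coef_terms b) -> ex_series (coef_terms (fun k => (a k + b k)%C)).
Proof.
intros Ha Hb.
apply (ex_series_le (K := R_AbsRing) (V := R_CompleteNormedModule) _
        (fun k => (1 + 1) * coef_terms a k + (1 + / 1) * coef_terms b k)).
- intros k; unfold norm; simpl; unfold abs; simpl.
  rewrite Rabs_pos_eq by apply coef_terms_ge0.
  apply coef_terms_plus_le; lra.
- apply ex_series_comb; assumption.
Qed.

Lemma coef_terms_scal c a k :
  coef_terms (fun n => (c * a n)%C) k = Cmod c ^ 2 * coef_terms a k.
Proof. unfold coef_terms; rewrite Cmod_mult; ring. Qed.

Lemma ex_coef_terms_scal c a : ex_series (coef_terms a) ->
  ex_series (coef_terms (fun k => (c * a k)%C)).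
Proof.
intros Ha.
apply ex_series_ext with (fun k => Cmod c ^ 2 * coef_terms a k).
- intros k; symmetry; apply coef_terms_scal.
- exact (ex_series_scal_l (Cmod c ^ 2) _ Ha).
Qed.

Lemma hardy_plus_taylor (f g : hardy) (z : disk) :
  is_pseries (V := C_NormedModule) (fun k => (hardy_coef f k + hardy_coef g k)%C)
    (disk_val z) (hardy_fun f z + hardy_fun g z)%C.
Proof.
exact (is_pseries_plus _ _ _ _ _ (hardy_taylor f z) (hardy_taylor g z)).
Qed.

Lemma hardy_scal_taylor (c : C) (f : hardy) (z : disk) :
  is_pseries (V := C_NormedModule) (fun k => (c * hardy_coef f k)%C)
    (disk_val z) (c * hardy_fun f z)%C.
Proof.
exact (is_pseries_scal (K := C_AbsRing) (V := C_NormedModule) c _ _ _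
         (Cmult_comm _ _) (hardy_taylor f z)).
Qed.

Lemma hardy_zero_taylor (z : disk) :
  is_pseries (V := C_NormedModule) (fun _ => RtoC 0) (disk_val z) (RtoC 0).
Proof.
apply filterlim_ext with (fun _ => RtoC 0); [|apply filterlim_const].
intros n; symmetry; induction n as [|n IH].
- rewrite sum_O; apply (scal_zero_r (V := C_ModuleSpace)).
- rewrite sum_Sn, IH.
  rewrite (scal_zero_r (V := C_ModuleSpace)).
  apply (plus_zero_l (G := C_AbelianGroup)).
Qed.

Lemma hardy_zero_summable : ex_series (coef_terms (fun _ => RtoC 0)).
Proof.
apply ex_series_ext with (fun k => (1 / 2) ^ k * 0).
- intros k; unfold coef_terms; rewrite Cmod_0; simpl; ring.
- apply ex_series_scal_r, ex_series_geom; rewrite Rabs_pos_eq; lra.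
Qed.

Definition hardy_zero : hardy := Hardy _ _ hardy_zero_taylor hardy_zero_summable.

Definition hardy_plus (f g : hardy) : hardy :=
  Hardy _ _ (hardy_plus_taylor f g)
    (ex_coef_terms_plus _ _ (hardy_summable f) (hardy_summable g)).

Definition hardy_scal (c : C) (f : hardy) : hardy :=
  Hardy _ _ (hardy_scal_taylor c f) (ex_coef_terms_scal c _ (hardy_summable f)).

Definition hardy_opp (f : hardy) : hardy := hardy_scal (RtoC (-1)) f.

Definition hardy_minus (f g : hardy) : hardy := hardy_plus f (hardy_opp g).

Lemma hardy_plus_comm f g : hardy_plus f g = hardy_plus g f.
Proof. apply hardy_eq; intros k; simpl; ring. Qed.

Lemma hardy_plus_assoc f g h :
  hardy_plus f (hardy_plus g h) = hardy_plus (hardy_plus f g) h.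
Proof. apply hardy_eq; intros k; simpl; ring. Qed.

Lemma hardy_plus_zero_r f : hardy_plus f hardy_zero = f.
Proof. apply hardy_eq; intros k; simpl; ring. Qed.

Lemma hardy_plus_opp_r f : hardy_plus f (hardy_opp f) = hardy_zero.
Proof.
apply hardy_eq; intros k; simpl.
apply injective_projections; simpl; ring.
Qed.

Definition hardy_AbelianMonoid_mixin :=
  AbelianMonoid.Mixin hardy hardy_plus hardy_zero
    hardy_plus_comm hardy_plus_assoc hardy_plus_zero_r.

Canonical hardy_AbelianMonoid :=
  AbelianMonoid.Pack hardy hardy_AbelianMonoid_mixin hardy.

Definition hardy_AbelianGroup_mixin :=
  AbelianGroup.Mixin hardy_AbelianMonoid hardy_opp hardy_plus_opp_r.

Canonical hardy_AbelianGroup :=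
  AbelianGroup.Pack hardy
    (AbelianGroup.Class hardy hardy_AbelianMonoid_mixin
       hardy_AbelianGroup_mixin) hardy.

Lemma hardy_scal_assoc (x y : C_Ring) (u : hardy) :
  hardy_scal x (hardy_scal y u) = hardy_scal (mult x y) u.
Proof. apply hardy_eq; intros k; apply Cmult_assoc. Qed.

Lemma hardy_scal_one (u : hardy) : hardy_scal (@one C_Ring) u = u.
Proof. apply hardy_eq; intros k; apply Cmult_1_l. Qed.

Lemma hardy_scal_distr_l (x : C_Ring) (u v : hardy) :
  hardy_scal x (plus u v) = plus (hardy_scal x u) (hardy_scal x v).
Proof. apply hardy_eq; intros k; apply Cmult_plus_distr_l. Qed.

Lemma hardy_scal_distr_r (x y : C_Ring) (u : hardy) :
  hardy_scal (plus x y) u = plus (hardy_scal x u) (hardy_scal y u).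
Proof. apply hardy_eq; intros k; apply Cmult_plus_distr_r. Qed.

Definition hardy_ModuleSpace_mixin :=
  ModuleSpace.Mixin C_Ring hardy_AbelianGroup hardy_scal
    hardy_scal_assoc hardy_scal_one hardy_scal_distr_l hardy_scal_distr_r.

Canonical hardy_ModuleSpace :=
  ModuleSpace.Pack C_Ring hardy
    (ModuleSpace.Class C_Ring hardy (AbelianGroup.class hardy_AbelianGroup)
       hardy_ModuleSpace_mixin) hardy.

Lemma hardy_norm_ge0 f : 0 <= hardy_norm f.
Proof. apply sqrt_pos. Qed.

Lemma hardy_norm_sqr f : hardy_norm f ^ 2 = Series (coef_terms (hardy_coef f)).
Proof.
unfold hardy_norm; apply pow2_sqrt, Series_ge0.
- apply coef_terms_ge0.
- apply hardy_summable.
Qed.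

Lemma hardy_norm_triangle f g :
  hardy_norm (hardy_plus f g) <= hardy_norm f + hardy_norm g.
Proof.
assert (Ha := hardy_norm_ge0 f); assert (Hb := hardy_norm_ge0 g).
assert (Key : forall t, 0 < t -> hardy_norm (hardy_plus f g) ^ 2
   <= (1 + t) * hardy_norm f ^ 2 + (1 + / t) * hardy_norm g ^ 2).
{ intros t Ht; rewrite !hardy_norm_sqr.
  assert (Sf := hardy_summable f); assert (Sg := hardy_summable g).
  rewrite <- (Series_scal_l (1 + t)), <- (Series_scal_l (1 + / t)).
  rewrite <- Series_plus; try (apply (ex_series_scal_l (V := R_NormedModule)); assumption).
  apply Series_le.
  - intros k; split; [apply coef_terms_ge0|apply coef_terms_plus_le; exact Ht].
  - apply ex_series_comb; assumption. }
apply le_epsilon; intros e He.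
apply Rsqr_incr_0_var; [|lra].
rewrite !Rsqr_pow2.
set (a := hardy_norm f) in *; set (b := hardy_norm g) in *.
set (d := e / 2).
assert (Hd : 0 < d) by (unfold d; lra).
assert (Ht : 0 < (b + d) / (a + d)) by (apply Rdiv_lt_0_compat; lra).
apply Rle_trans with (1 := Key _ Ht).
replace (/ ((b + d) / (a + d))) with ((a + d) / (b + d)) by (field; lra).
assert (E1 : (b + d) / (a + d) * a <= b + d).
{ apply Rle_trans with ((b + d) / (a + d) * (a + d)).
  - apply Rmult_le_compat_l; lra.
  - right; field; lra. }
assert (E2 : (a + d) / (b + d) * b <= a + d).
{ apply Rle_trans with ((a + d) / (b + d) * (b + d)).
  - apply Rmult_le_compat_l; [left; apply Rdiv_lt_0_compat; lra|lra].
  - right; field; lra. }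
assert (F1 := Rmult_le_compat_r a _ _ Ha E1).
assert (F2 := Rmult_le_compat_r b _ _ Hb E2).
replace e with (2 * d) by (unfold d; lra).
assert (0 <= a * d) by (apply Rmult_le_pos; lra).
assert (0 <= b * d) by (apply Rmult_le_pos; lra).
assert (0 <= d * d) by (apply Rmult_le_pos; lra).
ring_simplify; ring_simplify in F1; ring_simplify in F2; lra.
Qed.

Lemma hardy_norm_scal (c : C) f :
  hardy_norm (hardy_scal c f) = Cmod c * hardy_norm f.
Proof.
unfold hardy_norm; simpl.
rewrite (Series_ext _ (fun k => Cmod c ^ 2 * coef_terms (hardy_coef f) k))
  by (intros k; apply coef_terms_scal).
rewrite Series_scal_l, sqrt_mult_alt by apply pow2_ge_0.
rewrite sqrt_pow2 by apply Cmod_ge_0; reflexivity.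
Qed.

Lemma hardy_norm_eq0 f : hardy_norm f = 0 -> f = hardy_zero.
Proof.
intros H; apply hardy_eq; intros k.
assert (T : coef_terms (hardy_coef f) k = 0).
{ apply series_pos_eq0.
  - apply coef_terms_ge0.
  - apply hardy_summable.
  - rewrite <- hardy_norm_sqr, H; ring. }
apply Cmod_eq_0.
unfold coef_terms in T; assert (B := beta_pos k).
apply Rmult_integral in T; destruct T as [T|T].
- apply Rmult_integral in T; destruct T as [T|T]; [exact T|].
  rewrite Rmult_1_r in T; exact T.
- exfalso; assert (0 < beta w k ^ 2) by (apply pow_lt; exact B); lra.
Qed.

Definition hardy_ball (f : hardy) (e : R) (g : hardy) : Prop :=
  hardy_norm (minus g f) < e.

Lemma hardy_norm_zero : hardy_norm hardy_zero = 0.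
Proof.
unfold hardy_norm; rewrite <- sqrt_0; f_equal.
rewrite (Series_ext _ (fun k => 0 * 0)); [rewrite Series_scal_l; ring|].
intros k; simpl; unfold coef_terms; rewrite Cmod_0; ring.
Qed.

Lemma hardy_ball_center f (e : posreal) : hardy_ball f e f.
Proof.
unfold hardy_ball; rewrite minus_eq_zero.
change (hardy_norm hardy_zero < e).
rewrite hardy_norm_zero; apply cond_pos.
Qed.

Lemma hardy_ball_sym f g (e : R) : hardy_ball f e g -> hardy_ball g e f.
Proof.
unfold hardy_ball; intros H.
replace (minus f g) with (hardy_scal (RtoC (-1)) (minus g f)).
- rewrite hardy_norm_scal, Cmod_R, Rabs_left by lra; lra.
- rewrite <- (opp_minus (G := hardy_AbelianGroup) g f); reflexivity.
Qed.

Lemma hardy_ball_triangle f g h (e1 e2 : R) :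
  hardy_ball f e1 g -> hardy_ball g e2 h -> hardy_ball f (e1 + e2) h.
Proof.
unfold hardy_ball; intros H1 H2.
rewrite (minus_trans (G := hardy_AbelianGroup) g h f).
assert (T := hardy_norm_triangle (minus h g) (minus g f)).
change (hardy_norm (hardy_plus (minus h g) (minus g f)) < e1 + e2); lra.
Qed.

Definition hardy_UniformSpace_mixin :=
  UniformSpace.Mixin hardy hardy_zero hardy_ball
    hardy_ball_center hardy_ball_sym hardy_ball_triangle.

Canonical hardy_UniformSpace :=
  UniformSpace.Pack hardy hardy_UniformSpace_mixin hardy.

Canonical hardy_NormedModuleAux :=
  NormedModuleAux.Pack C_AbsRing hardy
    (NormedModuleAux.Class C_AbsRing hardy
       (ModuleSpace.class C_Ring hardy_ModuleSpace)
       (UniformSpace.class hardy_UniformSpace)) hardy.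

Lemma hardy_norm_scal_le (c : C_AbsRing) (f : hardy) :
  hardy_norm (scal c f) <= abs c * hardy_norm f.
Proof. right; apply hardy_norm_scal. Qed.

Lemma hardy_norm_ball (f g : hardy) (e : R) :
  hardy_norm (minus g f) < e -> ball f e g.
Proof. intros H; exact H. Qed.

Lemma hardy_ball_norm (f g : hardy) (e : posreal) :
  ball f e g -> hardy_norm (minus g f) < 1 * e.
Proof. intros H; rewrite Rmult_1_l; exact H. Qed.

Definition hardy_NormedModule_mixin :=
  NormedModule.Mixin C_AbsRing hardy_NormedModuleAux hardy_norm 1
    hardy_norm_triangle hardy_norm_scal_le hardy_norm_ball hardy_ball_norm
    hardy_norm_eq0.

Canonical hardy_NormedModule :=
  NormedModule.Pack C_AbsRing hardy
    (NormedModule.Class C_AbsRing hardy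
       (NormedModuleAux.class C_AbsRing hardy_NormedModuleAux)
       hardy_NormedModule_mixin) hardy.

End WeightedHardySpace.

Arguments hardy_fun {w} f z : rename.
Arguments hardy_coef {w} f k : rename.
Arguments hardy_taylor {w} f z : rename.
Arguments hardy_summable {w} f : rename.
Arguments hardy_norm {w} f : rename.

(** * Operators *)

Definition is_composition_operator {w : weight} (phi : disk -> disk)
    (T : hardy w -> hardy w) : Prop :=
  forall (f : hardy w) (z : disk), hardy_fun (T f) z = hardy_fun f (phi z).

(* [is_linear] includes boundedness. *)
Definition spectrum {V : NormedModule C_AbsRing} (T : V -> V) (lambda : C) : Prop :=
  ~ exists S : V -> V, is_linear S /\
      forall x : V,
        S (minus (T x) (scal (lambda : C_AbsRing) x)) = x /\
        minus (T (S x)) (scal (lambda : C_AbsRing) (S x)) = x.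

(* Main.v *)
Require Import Defs.
From Stdlib Require Import Reals Lra Lia Psatz ClassicalEpsilon.
From Coquelicot Require Import Coquelicot.
Open Scope R_scope.

(* Up to two rotations, which are isometries of [hardy w], phi is
   psi_r(z) = (z + r) / (1 + r z) with r = |phi(0)|. The Taylor coefficients A_k(s) of
   f o psi_s satisfy (1 - s^2) A_k' = (k + 1) A_{k+1} - (k - 1) A_{k-1}, because
   (1 - s^2) d/ds and (1 - z^2) d/dz agree on psi_s. With W_k = beta_k^2,
   polynomial growth gives |(k + 1) W_k - k W_{k+1}| <= (N + 1)^2 min(W_k, W_{k+1}), and summation
   by parts turns the system into (1 - s^2) E' <= 2 (N + 1)^2 E for E = sum W_k |A_k|^2. By
   Gronwall, ||C_phi|| <= ((1 + r) / (1 - r))^((N + 1)^2 / 2), which is below the required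
   exponent; the inverse of phi is an automorphism with the same r, so the Neumann series for
   C_phi and for its inverse give the annulus. *)

(** * The energy estimate for real coefficients *)

(** The obstacle in the system for A_k is that its factors k + 1 and k - 1 are unbounded, so no
    termwise estimate closes. They are skew up to a small error: in E' each product A_k A_{k+1}
    occurs twice with opposite signs, and what survives, (k + 1) W_k - k W_{k+1}, is bounded
    relative to W because w_k = 1 + O(1/k). Nor is it known beforehand that f o psi_s lies in the
    space, so E may be neither finite nor differentiable. The inequality is therefore proved for
    polynomials and for sums cut at k <= K. The cut leaves one boundary term; it dies as K grows,
    since the coefficients decay geometrically, uniformly for 0 <= s <= r, while beta_k is
    subexponential. General f are reached by completeness: the images of the Taylor polynomials are
    Cauchy, and bounded point evaluations identify the limit with f o phi. The matrix of f -> f o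
    psi_s on monomials is real, so real and imaginary parts evolve separately and the estimate needs
    only real sequences. *)

(* Coefficients of [b(z) (z + s) / (1 + s z)], read off from
   [(1 + s z) g(z) = (z + s) b(z)]. *)
Fixpoint next_coef (s : R) (b : nat -> R) (k : nat) : R :=
  match k with
  | O => s * b O
  | S k' => b k' + s * b (S k') - s * next_coef s b k'
  end.

(* [transl_coef s j k] is the coefficient of [z^k] in [((z + s) / (1 + s z))^j]. *)
Fixpoint transl_coef (s : R) (j : nat) : nat -> R :=
  match j with
  | O => fun k => match k with O => 1 | S _ => 0 end
  | S j' => next_coef s (transl_coef s j')
  end.

(* Coefficients of [(1 - z^2) b'(z)]. *)
Definition flow (b : nat -> R) (k : nat) : R :=
  match k with
  | O => b 1%nat
  | S k' => (INR k' + 2) * b (S (S k')) - INR k' * b k'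
  end.

(** Product rule in coefficients: [d/ds] and [(1 - z^2) / (1 - s^2) d/dz] are both derivations and
    agree on the factor [(z + s) / (1 + s z)], so agreement on [b] passes to the product. The
    induction differentiates the recursion of [next_coef] directly. *)
Lemma next_coef_derive (b : R -> nat -> R) (s : R) : s ^ 2 < 1 ->
  (forall k, is_derive (fun t => b t k) s (flow (b s) k / (1 - s ^ 2))) ->
  forall k, is_derive (fun t => next_coef t (b t) k) s
              (flow (next_coef s (b s)) k / (1 - s ^ 2)).
Proof.
intros Hs Hb.
assert (Hn : forall x y : R, x = y -> forall f : R -> R, is_derive f s x -> is_derive f s y)
  by (intros x y -> f H; exact H).
assert (Hid : is_derive (fun t : R => t) s 1) by apply (is_derive_id (K := R_AbsRing)).
assert (Hprod : forall (f : R -> R) x, is_derive f s x ->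
           is_derive (fun t => t * f t) s (f s + s * x)).
{ intros f x Hf.
  eapply Hn; [|apply (is_derive_mult (fun t => t) f s 1 x Hid Hf Rmult_comm)].
  unfold plus, mult; simpl; ring. }
induction k as [|k IH].
- simpl; eapply Hn; [|apply (Hprod _ _ (Hb 0%nat))]; simpl; field; lra.
- simpl.
  eapply Hn; [|apply (is_derive_minus _ _ s _ _
     (is_derive_plus _ _ s _ _ (Hb k) (Hprod _ _ (Hb (S k)))) (Hprod _ _ IH))].
  unfold minus, plus, opp; simpl.
  destruct k as [|k]; simpl flow; simpl next_coef.
  + simpl; field; lra.
  + change (match k with O => 1 | S _ => INR k + 1 end) with (INR (S k)).
    rewrite S_INR; field; lra.
Qed.

Lemma transl_coef_derive (s : R) (j k : nat) : s ^ 2 < 1 ->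
  is_derive (fun t => transl_coef t j k) s (flow (transl_coef s j) k / (1 - s ^ 2)).
Proof.
intros Hs; revert k; induction j as [|j IH]; intros k.
- simpl.
  replace (_ / _) with (zero (G := R_AbelianGroup)).
  + apply (is_derive_const (K := R_AbsRing) (V := R_NormedModule)).
  (* The flow kills the constant series 1; at index 1 this rests on the factor [INR 0] in front of
     [b 0]. *)
  + destruct k as [|[|k]]; unfold flow, zero; simpl; field; lra.
- exact (next_coef_derive (fun t => transl_coef t j) s Hs IH k).
Qed.

Lemma transl_coef_0 (j k : nat) :
  transl_coef 0 j k = if Nat.eqb j k then 1 else 0.
Proof.
revert k; induction j as [|j IH]; intros k; [destruct k; reflexivity|].
destruct k as [|k]; simpl; rewrite ?IH; ring.
Qed.

(** For [s > 0] the pole [-1/s] has modulus at least [1/r], hence lies beyond [1/q]; this is the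
    geometric rate. The base [2 / (q - r)] closes the recursion: with [D (q - r) = 2 B] one has
    [B (1 + r q) + r D <= q D]. *)
Lemma transl_coef_bound (r q : R) : 0 <= r < q -> q < 1 ->
  forall j k s, 0 <= s <= r ->
  Rabs (transl_coef s j k) <= (2 / (q - r)) ^ j * q ^ k.
Proof.
intros Hr Hq j; induction j as [|j IH]; intros k s Hs.
- destruct k as [|k]; simpl.
  + rewrite Rabs_R1; lra.
  + rewrite Rabs_R0; assert (0 < q ^ k) by (apply pow_lt; lra); nra.
- assert (HB : 0 < (2 / (q - r)) ^ j) by (apply pow_lt, Rdiv_lt_0_compat; lra).
  assert (HD : (2 / (q - r)) ^ S j * (q - r) = 2 * (2 / (q - r)) ^ j)
    by (simpl; field; lra).
  set (B := (2 / (q - r)) ^ j) in *; set (D := (2 / (q - r)) ^ S j) in *.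
  assert (HD0 : 0 < D) by (unfold D; apply pow_lt, Rdiv_lt_0_compat; lra).
  assert (HBD : B <= D) by nra.
  assert (Hmul : forall x y, Rabs x <= y -> Rabs (s * x) <= r * y).
  { intros x y Hx; rewrite Rabs_mult, (Rabs_pos_eq s) by lra.
    apply Rmult_le_compat; try lra; apply Rabs_pos. }
  induction k as [|k IHk].
  + specialize (IH 0%nat s Hs); apply Hmul in IH.
    simpl in *; apply Rle_trans with (1 := IH); nra.
  + assert (H1 := IH k s Hs); assert (H2 := Hmul _ _ (IH (S k) s Hs)).
    assert (H3 := Hmul _ _ IHk).
    assert (Hk : 0 < q ^ k) by (apply pow_lt; lra).
    simpl transl_coef in *.
    set (x := transl_coef s j k) in *.
    set (y := s * transl_coef s j (S k)) in *.
    set (z := s * next_coef s (transl_coef s j) k) in *.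
    replace (x + y - z) with ((x + y) + - z) by ring.
    apply Rle_trans with (1 := Rabs_triang _ _); rewrite Rabs_Ropp.
    assert (H4 := Rabs_triang x y).
    assert (H5 : Rabs (x + y) + Rabs z <= (B * (1 + r * q) + r * D) * q ^ k).
    { simpl in H2; replace (_ * q ^ k)
        with (B * q ^ k + r * (B * (q * q ^ k)) + r * (D * q ^ k)) by ring.
      lra. }
    apply Rle_trans with (1 := H5); simpl.
    replace (D * (q * q ^ k)) with ((D * q) * q ^ k) by ring.
    apply Rmult_le_compat_r; [lra|].
    assert (r * q <= 1) by nra.
    assert (B * (r * q) <= B * 1) by (apply Rmult_le_compat_l; lra).
    lra.
Qed.

Lemma sum_Sn_R (u : nat -> R) (n : nat) : sum_n u (S n) = sum_n u n + u (S n).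
Proof. exact (sum_Sn u n). Qed.

Ltac ring_R := match goal with |- @eq _ ?x ?y => change (@eq R x y); ring end.

Lemma sum_n_incr (u : nat -> R) (n p : nat) :
  (forall k, 0 <= u k) -> (n <= p)%nat -> sum_n u n <= sum_n u p.
Proof.
intros Hu Hnp; induction Hnp as [|p Hnp IH]; [lra|].
rewrite sum_Sn_R; specialize (Hu (S p)); lra.
Qed.

Lemma sum_n_truncate_le (u : nat -> R) (J K : nat) : (forall k, 0 <= u k) ->
  sum_n (fun k => if Nat.leb k J then u k else 0) K <= sum_n u J.
Proof.
intros Hu; destruct (Nat.le_gt_cases K J) as [HK|HK].
- rewrite (sum_n_ext_loc _ u).
  + apply sum_n_incr; assumption.
  + intros k Hk; rewrite (proj2 (Nat.leb_le k J)) by lia; reflexivity.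
- assert (H : (J <= K)%nat) by lia; clear HK; induction H as [|K HK IH].
  + right; apply sum_n_ext_loc; intros k Hk.
    rewrite (proj2 (Nat.leb_le k J)) by exact Hk; reflexivity.
  + rewrite sum_Sn_R, (proj2 (Nat.leb_gt (S K) J)) by lia; lra.
Qed.

Lemma sum_n_select {G : Ring} (a : nat -> G) (J k : nat) :
  sum_n (fun j => if Nat.eqb j k then a j else zero) J = if Nat.leb k J then a k else zero.
Proof.
induction J as [|n IH].
- rewrite sum_O; destruct k; reflexivity.
- rewrite sum_Sn, IH.
  destruct (Nat.eqb_spec (S n) k) as [E|E].
  + subst k; rewrite (proj2 (Nat.leb_gt (S n) n)), Nat.leb_refl by lia.
    apply plus_zero_l.
  + rewrite plus_zero_r.
    destruct (Nat.leb_spec k n), (Nat.leb_spec k (S n)); try reflexivity; lia.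
Qed.

(** * Summation by parts and the Gronwall estimate for polynomials *)

Section Energy.

Variable W : nat -> R.
Hypothesis W_ge0 : forall k, 0 <= W k.
Variable a : nat -> R.
Variable J : nat.

(** The coefficient of [z^k] in [p o psi_s], for the polynomial [p(z) = sum_{j <= J} a_j z^j]. *)
Definition transl_poly (s : R) (k : nat) : R :=
  sum_n (fun j => a j * transl_coef s j k) J.

Definition energy (s : R) (K : nat) : R :=
  sum_n (fun k => W k * transl_poly s k ^ 2) K.

(* Boundary term left by summation by parts at [K]. *)
Definition flux (s : R) (K : nat) : R :=
  2 * W K * (INR K + 1) * transl_poly s K * transl_poly s (S K).

Lemma flow_linear (s : R) (k : nat) :
  sum_n (fun j => a j * flow (transl_coef s j) k) J = flow (transl_poly s) k.
Proof.
unfold transl_poly; induction J as [|n IH].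
- destruct k; simpl; rewrite !sum_O; ring_R.
- rewrite sum_Sn, IH; destruct k; simpl; rewrite !sum_Sn; unfold plus; simpl; ring_R.
Qed.

Lemma transl_poly_derive (s : R) (k : nat) : s ^ 2 < 1 ->
  is_derive (fun t => transl_poly t k) s (flow (transl_poly s) k / (1 - s ^ 2)).
Proof.
intros Hs.
replace (flow (transl_poly s) k / (1 - s ^ 2))
  with (sum_n (fun j => a j * (flow (transl_coef s j) k / (1 - s ^ 2))) J).
- apply (is_derive_sum_n (K := R_AbsRing) (V := R_NormedModule)
           (fun j t => a j * transl_coef t j k)).
  intros j _; apply is_derive_scal, transl_coef_derive; exact Hs.
- rewrite <- flow_linear; unfold Rdiv.
  rewrite <- (sum_n_mult_r (K := R_Ring)).
  apply sum_n_ext; intros j; unfold mult; simpl; ring.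
Qed.

(** Interior part of the summation by parts: the product of the coefficients [k] and [k + 1] enters
    the derivative of the energy once from each index, with factors [2 W_k (k + 1)] and
    [- 2 W_{k+1} k]. *)
Fixpoint exchange (s : R) (K : nat) : R :=
  match K with
  | O => 0
  | S k => exchange s k
           + 2 * (W k * (INR k + 1) - W (S k) * INR k) * transl_poly s k * transl_poly s (S k)
  end.

(** Within the cut sum only the product of the coefficients [K] and [K + 1] lacks its second half;
    what remains of it is [flux]. *)
Lemma energy_derive (s : R) (K : nat) : s ^ 2 < 1 ->
  is_derive (fun t => energy t K) s ((exchange s K + flux s K) / (1 - s ^ 2)).
Proof.
intros Hs.
assert (Hterm : forall k, is_derive (fun t => W k * transl_poly t k ^ 2) s
          (W k * (2 * transl_poly s k * (flow (transl_poly s) k / (1 - s ^ 2))))).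
{ intros k; apply is_derive_scal.
  replace (2 * _ * _) with (INR 2 * (flow (transl_poly s) k / (1 - s ^ 2))
      * transl_poly s k ^ pred 2) by (simpl; ring).
  apply is_derive_pow, transl_poly_derive; exact Hs. }
induction K as [|K IH].
- unfold energy.
  apply is_derive_ext with (fun t => W 0%nat * transl_poly t 0 ^ 2).
  { intros t; rewrite sum_O; reflexivity. }
  replace (_ / _) with (W 0%nat * (2 * transl_poly s 0 * (flow (transl_poly s) 0 / (1 - s ^ 2)))).
  + apply Hterm.
  + unfold flux; simpl; field; lra.
- apply is_derive_ext with (fun t => plus (energy t K) (W (S K) * transl_poly t (S K) ^ 2)).
  { intros t; unfold energy; rewrite sum_Sn; reflexivity. }
  eapply eq_ind; [apply (is_derive_plus _ _ s _ _ IH (Hterm (S K)))|].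
  unfold flux, plus; simpl exchange; simpl flow; rewrite S_INR; simpl; field; lra.
Qed.

(** [psi_0] is the identity, so [transl_poly 0 k] is [a k] up to [J] and 0 beyond. *)
Lemma energy_0_le (K : nat) : energy 0 K <= sum_n (fun j => W j * a j ^ 2) J.
Proof.
apply Rle_trans with (2 := sum_n_truncate_le (fun j => W j * a j ^ 2) J K
        (fun j => Rmult_le_pos _ _ (W_ge0 j) (pow2_ge_0 (a j)))).
right; apply sum_n_ext; intros k; unfold transl_poly.
rewrite (sum_n_ext _ (fun j => if Nat.eqb j k then a j else 0)).
- replace (sum_n _ J) with (if Nat.leb k J then a k else 0)
    by (symmetry; exact (sum_n_select (G := R_Ring) a J k)).
  destruct (Nat.leb k J); ring_R.
- intros j; rewrite transl_coef_0; destruct (Nat.eqb j k); ring_R.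
Qed.

Lemma transl_poly_bound (r q : R) : 0 <= r < q -> q < 1 ->
  exists B, 0 <= B /\ forall k s, 0 <= s <= r -> Rabs (transl_poly s k) <= B * q ^ k.
Proof.
intros Hr Hq; unfold transl_poly.
assert (Hterm : forall j k s, 0 <= s <= r ->
   Rabs (a j * transl_coef s j k) <= Rabs (a j) * (2 / (q - r)) ^ j * q ^ k).
{ intros j k s Hs; rewrite Rabs_mult, Rmult_assoc.
  apply Rmult_le_compat_l; [apply Rabs_pos|].
  apply (transl_coef_bound r); assumption. }
assert (Hpos : forall j, 0 <= Rabs (a j) * (2 / (q - r)) ^ j).
{ intros j; apply Rmult_le_pos; [apply Rabs_pos|].
  apply pow_le, Rlt_le, Rdiv_lt_0_compat; lra. }
induction J as [|n [B [HB IH]]].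
- exists (Rabs (a 0%nat) * (2 / (q - r)) ^ 0); split; [apply Hpos|].
  intros k s Hs; rewrite sum_O; apply Hterm; exact Hs.
- exists (B + Rabs (a (S n)) * (2 / (q - r)) ^ S n); split.
  + apply Rplus_le_le_0_compat; [exact HB|apply Hpos].
  + intros k s Hs; rewrite sum_Sn_R, Rmult_plus_distr_r.
    apply Rle_trans with (1 := Rabs_triang _ _).
    apply Rplus_le_compat; [apply IH|apply Hterm]; exact Hs.
Qed.

Variable m : nat.
Hypothesis W_growth : forall k,
  Rabs (W k * (INR k + 1) - W (S k) * INR k) <= INR m * W k /\
  Rabs (W k * (INR k + 1) - W (S k) * INR k) <= INR m * W (S k).

(** The inequality [2 x y <= x^2 + y^2] splits each product between its two indices, and the two
    halves of [W_growth] charge them to [W k] and [W (S k)]. An index meets at most two products,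
    whence the factor 2. *)
Lemma exchange_le (s : R) (K : nat) : exchange s K <= 2 * INR m * energy s K.
Proof.
assert (Hm := pos_INR m).
(* Index [K] has been charged only once so far; recording its unspent share makes the induction
   close. *)
assert (H : exchange s K <= 2 * INR m * energy s K - INR m * W K * transl_poly s K ^ 2).
{ induction K as [|K IH].
  - unfold energy; rewrite sum_O; simpl.
    assert (0 <= INR m * W 0%nat * transl_poly s 0 ^ 2)
      by (apply Rmult_le_pos; [apply Rmult_le_pos; [exact Hm|apply W_ge0]|apply pow2_ge_0]).
    simpl in *; lra.
  - unfold energy in *; rewrite sum_Sn_R; simpl exchange.
    destruct (W_growth K) as [H1 H2].
    set (d := W K * (INR K + 1) - W (S K) * INR K) in *.
    set (x := transl_poly s K) in *; set (y := transl_poly s (S K)) in *.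
    assert (Hxy : 2 * d * x * y <= Rabs d * x ^ 2 + Rabs d * y ^ 2).
    { destruct (Rle_or_lt 0 d) as [Hd|Hd].
      - rewrite Rabs_pos_eq by exact Hd.
        assert (0 <= d * (x - y) ^ 2) by (apply Rmult_le_pos; [lra|apply pow2_ge_0]).
        lra.
      - rewrite Rabs_left by exact Hd.
        assert (0 <= - d * (x + y) ^ 2) by (apply Rmult_le_pos; [lra|apply pow2_ge_0]).
        lra. }
    assert (Hx := Rmult_le_compat_r _ _ _ (pow2_ge_0 x) H1).
    assert (Hy := Rmult_le_compat_r _ _ _ (pow2_ge_0 y) H2).
    simpl in *; lra. }
assert (0 <= INR m * W K * transl_poly s K ^ 2)
  by (apply Rmult_le_pos; [apply Rmult_le_pos; [exact Hm|apply W_ge0]|apply pow2_ge_0]).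
lra.
Qed.


(** [((1 - t) / (1 + t)) ^ m] is the integrating factor: its logarithmic derivative is
    [- 2 m / (1 - t^2)], the opposite of the growth rate allowed by [exchange_le]. *)
Lemma damped_energy_derive (s : R) (K : nat) : 0 <= s < 1 ->
  is_derive (fun t => ((1 - t) / (1 + t)) ^ m * energy t K) s
    (((1 - s) / (1 + s)) ^ m / (1 - s ^ 2)
       * (exchange s K + flux s K - 2 * INR m * energy s K)).
Proof.
intros Hs.
assert (Hs2 : s ^ 2 < 1) by nra.
assert (Hy : is_derive (fun t => (1 - t) / (1 + t)) s
               ((1 - s) / (1 + s) * (- 2 / (1 - s ^ 2)))).
{ auto_derive; [lra|field; split; nra]. }
assert (Hpow : is_derive (fun t => ((1 - t) / (1 + t)) ^ m) s
   (INR m * (- 2 / (1 - s ^ 2)) * ((1 - s) / (1 + s)) ^ m)).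
{ eapply eq_ind; [apply (is_derive_pow _ m _ _ Hy)|].
  destruct m as [|p]; [simpl; ring_R|].
  change (pred (S p)) with p; set (y := (1 - s) / (1 + s)); simpl pow; ring_R. }
eapply eq_ind; [apply (is_derive_mult _ _ s _ _ Hpow (energy_derive s K Hs2) Rmult_comm)|].
unfold plus, mult; simpl; field; nra.
Qed.

Hypothesis W_decay : forall q, 0 < q < 1 ->
  is_lim_seq (fun k => W k * (INR k + 1) * q ^ k) 0.

(* Gronwall on the truncated energy; the flux through [K] tends to 0 uniformly in [s] because
   the coefficients decay geometrically. *)
Lemma energy_le (r : R) (K : nat) : 0 <= r < 1 ->
  energy r K <= ((1 + r) / (1 - r)) ^ m * sum_n (fun j => W j * a j ^ 2) J.
Proof.
intros Hr.
set (q := (1 + r) / 2).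
assert (Hq : r < q < 1) by (unfold q; lra).
destruct (transl_poly_bound r q) as [B [HB Hbound]]; [lra|lra|].
set (delta := fun k => W k * (INR k + 1) * q ^ k).
set (C := 2 * (B * B) / (1 - r ^ 2) * r).
assert (Hflux : forall s k, 0 <= s <= r -> flux s k <= 2 * (B * B) * delta k).
{ intros s k Hs; unfold flux, delta.
  assert (H1 := Hbound k s Hs); assert (H2 := Hbound (S k) s Hs).
  assert (Hqk : 0 < q ^ k) by (apply pow_lt; lra).
  assert (Hqk1 : q ^ S k <= 1).
  { rewrite <- (pow1 (S k)); apply pow_incr; lra. }
  assert (H3 : transl_poly s k * transl_poly s (S k) <= (B * q ^ k) * B).
  { apply Rle_trans with (1 := Rle_abs _); rewrite Rabs_mult.
    apply Rmult_le_compat; try apply Rabs_pos; [exact H1|].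
    apply Rle_trans with (1 := H2).
    rewrite <- (Rmult_1_r B) at 2; apply Rmult_le_compat_l; assumption. }
  assert (H4 : 0 <= 2 * W k * (INR k + 1)).
  { assert (H5 := pos_INR k); assert (H6 := W_ge0 k).
    apply Rmult_le_pos; lra. }
  assert (H5 := Rmult_le_compat_l _ _ _ H4 H3); lra. }
assert (Hr2 : r ^ 2 < 1) by nra.
(* The mean value theorem stands in for integration: on [[0, r]] the derivative is at most
   [/ (1 - r ^ 2)] times the flux bound, so the damped energy rises by at most [C * delta k]. *)
assert (Hstep : forall k, ((1 - r) / (1 + r)) ^ m * energy r k
          <= sum_n (fun j => W j * a j ^ 2) J + C * delta k).
{ intros k.
  destruct (MVT_gen (fun t => ((1 - t) / (1 + t)) ^ m * energy t k) 0 r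
     (fun s => ((1 - s) / (1 + s)) ^ m / (1 - s ^ 2)
       * (exchange s k + flux s k - 2 * INR m * energy s k))) as [s [Hs E]].
  - intros x; rewrite Rmin_left, Rmax_right by lra; intros Hx.
    apply damped_energy_derive; lra.
  - intros x; rewrite Rmin_left, Rmax_right by lra; intros Hx.
    apply derivable_continuous_pt; eexists.
    apply is_derive_Reals, damped_energy_derive; lra.
  - rewrite Rmin_left, Rmax_right in Hs by lra.
    assert (E0 := energy_0_le k).
    replace ((1 - 0) / (1 + 0)) with 1 in E by field; rewrite pow1 in E.
    assert (Hle : exchange s k + flux s k - 2 * INR m * energy s k
                  <= 2 * (B * B) * delta k).
    { assert (H1 := exchange_le s k); assert (H2 := Hflux s k Hs); lra. }
    assert (Hdelta : 0 <= 2 * (B * B) * delta k).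
    { unfold delta; apply Rmult_le_pos; [nra|].
      apply Rmult_le_pos; [|apply pow_le; lra].
      assert (H5 := pos_INR k); apply Rmult_le_pos; [apply W_ge0|lra]. }
    assert (Hs2 : 1 - r ^ 2 <= 1 - s ^ 2) by nra.
    assert (Hc : 0 <= ((1 - s) / (1 + s)) ^ m / (1 - s ^ 2) <= / (1 - r ^ 2)).
    { assert (Hy : 0 <= (1 - s) / (1 + s) <= 1).
      { split; [apply Rle_mult_inv_pos; lra|].
        apply Rmult_le_reg_r with (1 + s); [lra|].
        unfold Rdiv; rewrite Rmult_assoc, Rinv_l; lra. }
      assert (Hym : 0 <= ((1 - s) / (1 + s)) ^ m <= 1).
      { split; [apply pow_le; lra|apply Rle_trans with (1 ^ m);
          [apply pow_incr; exact Hy|rewrite pow1; lra]]. }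
      assert (Hinv : 0 < / (1 - s ^ 2)) by (apply Rinv_0_lt_compat; lra).
      unfold Rdiv; split; [apply Rmult_le_pos; lra|].
      apply Rle_trans with (1 * / (1 - s ^ 2)); [apply Rmult_le_compat_r; lra|].
      rewrite Rmult_1_l; apply Rinv_le_contravar; lra. }
    assert (Hd : ((1 - s) / (1 + s)) ^ m / (1 - s ^ 2)
        * (exchange s k + flux s k - 2 * INR m * energy s k)
        <= / (1 - r ^ 2) * (2 * (B * B) * delta k)).
    { apply Rle_trans with (((1 - s) / (1 + s)) ^ m / (1 - s ^ 2) * (2 * (B * B) * delta k)).
      - apply Rmult_le_compat_l; lra.
      - apply Rmult_le_compat_r; lra. }
    assert (Hdr := Rmult_le_compat_r r _ _ (proj1 Hr) Hd).
    replace (C * delta k) with (/ (1 - r ^ 2) * (2 * (B * B) * delta k) * r)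
      by (unfold C; field; lra).
    rewrite Rminus_0_r in E; lra. }
(* [K] stays fixed while the cut [k] goes to infinity: [energy r K <= energy r k] once [k >= K], and
   the flux error disappears. *)
assert (Hlim : Rbar_le (((1 - r) / (1 + r)) ^ m * energy r K)
                 (sum_n (fun j => W j * a j ^ 2) J + C * 0)).
{ apply is_lim_seq_le_loc with (fun _ => ((1 - r) / (1 + r)) ^ m * energy r K)
    (fun k => sum_n (fun j => W j * a j ^ 2) J + C * delta k).
  - exists K; intros k Hk.
    apply Rle_trans with (2 := Hstep k), Rmult_le_compat_l.
    + apply pow_le, Rle_mult_inv_pos; lra.
    + apply sum_n_incr; [|exact Hk].
      intros i; apply Rmult_le_pos; [apply W_ge0|apply pow2_ge_0].
  - apply is_lim_seq_const.
  - apply is_lim_seq_plus'; [apply is_lim_seq_const|].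
    apply (is_lim_seq_scal_l delta C 0), W_decay; lra. }
simpl in Hlim; rewrite Rmult_0_r, Rplus_0_r in Hlim.
assert (Hinv : ((1 + r) / (1 - r)) ^ m * ((1 - r) / (1 + r)) ^ m = 1).
{ rewrite <- Rpow_mult_distr.
  replace ((1 + r) / (1 - r) * _) with 1 by (field; lra); apply pow1. }
assert (HL : 0 <= ((1 + r) / (1 - r)) ^ m) by (apply pow_le, Rle_mult_inv_pos; lra).
assert (H := Rmult_le_compat_l _ _ _ HL Hlim).
rewrite <- Rmult_assoc, Hinv, Rmult_1_l in H; exact H.
Qed.

End Energy.

(** * Weights, point evaluations and completeness *)

(** With [y = 1 + h] the hypothesis gives [t |h| <= n], and [h <= n] when [h >= 0]; then
    [y^2 - 1 = 2 h + h^2]. The hypothesis is symmetric under [y -> 1/y], so the lemma applies to a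
    weight and to its inverse. *)
Lemma ratio_square_bound (n x y t : R) :
  0 <= n -> 1 <= x -> 0 <= t <= x -> x / (x + n) <= y <= (x + n) / x ->
  t * (y ^ 2 - 1) <= 2 * n + n ^ 2 /\ t * (1 - y ^ 2) <= 2 * n.
Proof.
intros Hn Hx Ht [H1 H2].
assert (H1' : x <= y * (x + n)).
{ apply Rmult_le_compat_r with (r := x + n) in H1; [|lra].
  unfold Rdiv in H1; rewrite Rmult_assoc, Rinv_l in H1 by lra; lra. }
assert (H2' : y * x <= x + n).
{ apply Rmult_le_compat_r with (r := x) in H2; [|lra].
  unfold Rdiv in H2; rewrite Rmult_assoc, Rinv_l in H2 by lra; lra. }
assert (Hy : 0 < y) by nra.
set (h := y - 1); replace y with (1 + h) in * by (unfold h; ring); clearbody h.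
destruct (Rle_or_lt 0 h) as [Hh|Hh].
- assert (A : h * x <= n) by nra.
  assert (B : h <= n) by nra.
  assert (D : 0 <= t * h <= n) by nra.
  assert (E : t * h * h <= n * n) by (apply Rmult_le_compat; lra).
  split; nra.
- assert (A : - h * x <= n) by nra.
  assert (D : 0 <= t * - h <= n) by nra.
  assert (E : 0 <= t * (h * h)) by nra.
  split; nra.
Qed.

(** With [g = w_{k+1}], factoring out [beta_k^2] leaves [1 - k (g^2 - 1)], and factoring out
    [beta_{k+1}^2] leaves [1 + (k + 1) (g^{-2} - 1)]. The latter is bounded by [1 + 2 N + N^2], the
    origin of [(N + 1)^2]. *)
Lemma sqr_beta_growth (N : nat) (w : weight) : polynomial_growth N w ->
  forall k,
    Rabs (beta w k ^ 2 * (INR k + 1) - beta w (S k) ^ 2 * INR k)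
      <= (INR N + 1) ^ 2 * beta w k ^ 2 /\
    Rabs (beta w k ^ 2 * (INR k + 1) - beta w (S k) ^ 2 * INR k)
      <= (INR N + 1) ^ 2 * beta w (S k) ^ 2.
Proof.
intros Hw k.
assert (Hk := pos_INR k); assert (Hn := pos_INR N).
assert (Hg := weight_pos w (S k) ltac:(lia)).
assert (Hb := pow_lt _ 2 (beta_pos w k)).
specialize (Hw (S k) ltac:(lia)); rewrite S_INR in Hw.
simpl beta; set (g := w (S k)) in *; set (b := beta w k) in *.
(* The weight involved is [w (S k)], so the growth condition has [k + 2] as its numerator or
   denominator; the multipliers [k] and [k + 1] both stay below it. *)
set (x := INR k + 1 + 1) in *.
replace (INR k + 1 + INR N + 1) with (x + INR N) in Hw by (unfold x; ring).
assert (Hinv : x / (x + INR N) <= / g <= (x + INR N) / x).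
{ replace (x / (x + INR N)) with (/ ((x + INR N) / x)) by (field; unfold x; lra).
  replace ((x + INR N) / x) with (/ (x / (x + INR N))) at 2 by (field; unfold x; lra).
  assert (0 < x / (x + INR N)) by (apply Rdiv_lt_0_compat; unfold x; lra).
  split; apply Rinv_le_contravar; lra. }
destruct (ratio_square_bound (INR N) x g (INR k)) as [A1 A2]; try (unfold x; lra); [exact Hw|].
destruct (ratio_square_bound (INR N) x (/ g) (INR k + 1)) as [B1 B2]; try (unfold x; lra);
  [exact Hinv|].
replace (b ^ 2 * (INR k + 1) - (b * g) ^ 2 * INR k)
  with (b ^ 2 * (1 - INR k * (g ^ 2 - 1))) by ring.
assert (Hfac : b ^ 2 * (1 - INR k * (g ^ 2 - 1))
  = (b * g) ^ 2 * ((INR k + 1) * ((/ g) ^ 2 - 1) + 1)) by (field; lra).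
split.
- rewrite Rabs_mult, (Rabs_pos_eq (b ^ 2)), Rmult_comm by lra.
  apply Rmult_le_compat_r; [lra|apply Rabs_le; split; nra].
- assert (Hbg : 0 < (b * g) ^ 2) by (apply pow_lt, Rmult_lt_0_compat; [apply beta_pos|exact Hg]).
  rewrite Hfac, Rabs_mult, (Rabs_pos_eq ((b * g) ^ 2)), Rmult_comm by lra.
  apply Rmult_le_compat_r; [lra|apply Rabs_le; split; nra].
Qed.

Lemma sqr_weight_lim (w : weight) : is_lim_seq (fun k => w (S k) ^ 2) 1.
Proof.
assert (H : is_lim_seq (fun k => w (S k)) 1)
  by (apply -> (is_lim_seq_incr_1 w); apply weight_lim).
replace 1 with (1 * 1) by ring.
apply is_lim_seq_ext with (fun k => w (S k) * w (S k)); [intros k; ring|].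
apply is_lim_seq_mult'; exact H.
Qed.

(** Since [w_k -> 1], the ratio of consecutive terms tends to [q]. This is the subexponential growth
    of [beta] that kills the flux. *)
Lemma sqr_beta_pow_summable (w : weight) (q : R) : 0 < q < 1 ->
  ex_series (fun k => beta w k ^ 2 * (INR k + 1) * q ^ k).
Proof.
intros Hq.
assert (Hpos : forall k, 0 < beta w k ^ 2 * (INR k + 1) * q ^ k).
{ intros k; assert (Hk := pos_INR k).
  apply Rmult_lt_0_compat; [apply Rmult_lt_0_compat|apply pow_lt; lra];
    [apply pow_lt, beta_pos|lra]. }
apply ex_series_ext with (fun k => Rabs (beta w k ^ 2 * (INR k + 1) * q ^ k)).
{ intros k; apply Rabs_pos_eq, Rlt_le, Hpos. }
apply ex_series_DAlembert with q; [lra|intros k; specialize (Hpos k); lra|].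
apply is_lim_seq_ext with (fun k => w (S k) ^ 2 * (1 + / INR (S k)) * q).
{ intros k; rewrite Rabs_pos_eq.
  - assert (Hk := pos_INR k); assert (B := beta_pos w k).
    assert (Q := pow_lt q k (proj1 Hq)).
    rewrite !S_INR; simpl; field; lra.
  - apply Rlt_le, Rdiv_lt_0_compat; apply Hpos. }
replace q with (1 * (1 + 0) * q) at 1 by ring.
apply is_lim_seq_mult'; [|apply is_lim_seq_const].
apply is_lim_seq_mult'; [apply sqr_weight_lim|].
apply is_lim_seq_plus'; [apply is_lim_seq_const|].
apply -> (is_lim_seq_incr_1 (fun k => / INR k)).
apply (is_lim_seq_inv INR p_infty); [apply is_lim_seq_INR|discriminate].
Qed.

Lemma inv_sqr_beta_pow_summable (w : weight) (q : R) : 0 <= q < 1 ->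
  ex_series (fun k => q ^ k / beta w k ^ 2).
Proof.
intros Hq0.
(* The ratio test needs nonzero terms, and [q] is 0 at the centre of the disk; the larger [p] is
   positive. *)
set (p := (1 + q) / 2); assert (Hp : q <= p < 1 /\ 0 < p) by (unfold p; lra).
assert (Hb := fun k => pow_lt _ 2 (beta_pos w k)).
assert (Hpos : forall k, 0 < p ^ k / beta w k ^ 2).
{ intros k; apply Rdiv_lt_0_compat; [apply pow_lt; lra|apply Hb]. }
apply (ex_series_le (K := R_AbsRing) (V := R_CompleteNormedModule) _
         (fun k => Rabs (p ^ k / beta w k ^ 2))).
{ intros k; change (Rabs (q ^ k / beta w k ^ 2) <= Rabs (p ^ k / beta w k ^ 2)).
  assert (H := Rinv_0_lt_compat _ (Hb k)).
  rewrite !Rabs_pos_eq.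
  - apply Rmult_le_compat_r; [lra|apply pow_incr; lra].
  - apply Rlt_le, Hpos.
  - apply Rmult_le_pos; [apply pow_le; lra|lra]. }
apply ex_series_DAlembert with p; [lra|intros k; specialize (Hpos k); lra|].
apply is_lim_seq_ext with (fun k => p / (w (S k) ^ 2)).
{ intros k; rewrite Rabs_pos_eq.
  - assert (B := beta_pos w k); assert (Hg := weight_pos w (S k) ltac:(lia)).
    assert (Q := pow_lt p k (proj2 Hp)).
    simpl; field; lra.
  - apply Rlt_le, Rdiv_lt_0_compat; apply Hpos. }
replace (Finite p) with (Rbar_div p 1) by (simpl; f_equal; field).
apply is_lim_seq_div'; [apply is_lim_seq_const|apply sqr_weight_lim|lra].
Qed.

Lemma sum_n_le_Series (u : nat -> R) (n : nat) :
  (forall k, 0 <= u k) -> ex_series u -> sum_n u n <= Series u.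
Proof.
intros Hu Ex.
apply (is_lim_seq_incr_compare (sum_n u)); [exact (Series_correct _ Ex)|].
intros k; rewrite sum_Sn_R; specialize (Hu (S k)); lra.
Qed.

Lemma series_bounded (u : nat -> R) (M : R) :
  (forall k, 0 <= u k) -> (forall n, sum_n u n <= M) -> ex_series u /\ Series u <= M.
Proof.
intros Hu HM.
assert (Ex : ex_series u).
{ apply (ex_finite_lim_seq_incr (sum_n u) M); [|exact HM].
  intros k; rewrite sum_Sn_R; specialize (Hu (S k)); lra. }
split; [exact Ex|].
apply (is_lim_seq_le (sum_n u) (fun _ => M) (Series u) M HM).
- exact (Series_correct _ Ex).
- apply is_lim_seq_const.
Qed.

Lemma norm_limit_le {K : AbsRing} {V : NormedModule K} (u : nat -> V) (l : V) (M : R) :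
  filterlim u eventually (locally l) -> (forall n, norm (u n) <= M) -> norm l <= M.
Proof.
intros Hl HM.
apply (is_lim_seq_le (fun n => norm (u n)) (fun _ => M) (norm l) M HM).
- exact (filterlim_comp _ _ _ _ _ _ _ _ Hl (filterlim_norm l)).
- apply is_lim_seq_const.
Qed.

(** * Point evaluations, uniqueness of Taylor coefficients, completeness *)

Section Hardy.

Variable w : weight.

Lemma hardy_coef_minus (f g : hardy w) k :
  hardy_coef (minus f g) k = (hardy_coef f k - hardy_coef g k)%C.
Proof.
change (hardy_coef f k + RtoC (-1) * hardy_coef g k = hardy_coef f k - hardy_coef g k)%C.
apply injective_projections; simpl; ring.
Qed.

Lemma hardy_fun_minus (f g : hardy w) z :
  hardy_fun (minus f g) z = (hardy_fun f z - hardy_fun g z)%C.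
Proof.
change (hardy_fun f z + RtoC (-1) * hardy_fun g z = hardy_fun f z - hardy_fun g z)%C.
apply injective_projections; simpl; ring.
Qed.

Lemma hardy_coef_le (f : hardy w) k : Cmod (hardy_coef f k) * beta w k <= hardy_norm f.
Proof.
apply Rsqr_incr_0_var; [|apply hardy_norm_ge0].
rewrite !Rsqr_pow2, hardy_norm_sqr, Rpow_mult_distr.
apply Rle_trans with (sum_n (coef_terms w (hardy_coef f)) k).
- destruct k as [|k]; [rewrite sum_O; apply Rle_refl|].
  rewrite sum_Sn_R.
  assert (H : 0 <= sum_n (coef_terms w (hardy_coef f)) k).
  { apply Rle_trans with (sum_n (coef_terms w (hardy_coef f)) 0).
    - rewrite sum_O; apply coef_terms_ge0.
    - apply sum_n_incr; [apply coef_terms_ge0|lia]. }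
  unfold coef_terms in *; lra.
- apply sum_n_le_Series; [apply coef_terms_ge0|apply hardy_summable].
Qed.

Lemma hardy_norm_le (f : hardy w) (M : R) : 0 <= M ->
  (forall n, sum_n (coef_terms w (hardy_coef f)) n <= M ^ 2) -> hardy_norm f <= M.
Proof.
intros HM H; apply Rsqr_incr_0_var; [|exact HM].
rewrite !Rsqr_pow2, hardy_norm_sqr.
apply series_bounded; [apply coef_terms_ge0|exact H].
Qed.

(* AM-GM with parameter [t]. *)
Lemma taylor_term_le (a : nat -> C) (z : C) (t : R) k : 0 < t ->
  norm (scal (pow_n (K := C_Ring) z k) (a k) : C_NormedModule)
    <= t / 2 * coef_terms w a k + / (2 * t) * ((Cmod z ^ 2) ^ k / beta w k ^ 2).
Proof.
intros Ht.
assert (Hp : norm (scal (pow_n (K := C_Ring) z k) (a k) : C_NormedModule)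
             = Cmod z ^ k * Cmod (a k)).
{ change (Cmod (pow_n (K := C_Ring) z k * a k)%C = Cmod z ^ k * Cmod (a k)).
  rewrite Cmod_mult; f_equal.
  induction k as [|k IH]; [exact Cmod_1|].
  change (Cmod (z * pow_n (K := C_Ring) z k)%C = Cmod z * Cmod z ^ k).
  rewrite Cmod_mult, IH; reflexivity. }
rewrite Hp, <- pow_mult, Nat.mul_comm, pow_mult; unfold coef_terms.
set (x := Cmod (a k)); set (y := Cmod z ^ k).
assert (B := beta_pos w k); set (b := beta w k) in *.
assert (E : t / 2 * (x ^ 2 * b ^ 2) + / (2 * t) * (y ^ 2 / b ^ 2) - y * x
  = / (2 * t) * (t * (x * b) - y / b) ^ 2) by (field; lra).
assert (0 <= / (2 * t) * (t * (x * b) - y / b) ^ 2).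
{ apply Rmult_le_pos; [left; apply Rinv_0_lt_compat; lra|apply pow2_ge_0]. }
lra.
Qed.

Lemma disk_pow_summable (z : disk) :
  ex_series (fun k => (Cmod (disk_val z) ^ 2) ^ k / beta w k ^ 2).
Proof.
apply inv_sqr_beta_pow_summable; destruct z as [z Hz]; simpl disk_val.
assert (H := Cmod_ge_0 z); nra.
Qed.

Lemma hardy_of_coef (a : nat -> C) : ex_series (coef_terms w a) ->
  exists f : hardy w, forall k, hardy_coef f k = a k.
Proof.
intros Ha.
assert (Ex : forall z : disk, exists l : C,
          is_pseries (V := C_NormedModule) a (disk_val z) l).
{ intros z.
  apply (ex_series_le (K := C_AbsRing) (V := C_CompleteNormedModule)
    (fun k => scal (pow_n (K := C_Ring) (disk_val z) k) (a k))
    (fun k => 1 / 2 * coef_terms w a k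
              + / (2 * 1) * ((Cmod (disk_val z) ^ 2) ^ k / beta w k ^ 2))).
  - intros k; apply taylor_term_le; lra.
  - apply ex_series_comb; [exact Ha|apply disk_pow_summable]. }
exists (Hardy w (fun z => proj1_sig (constructive_indefinite_description _ (Ex z))) a
          (fun z => proj2_sig (constructive_indefinite_description _ (Ex z))) Ha).
reflexivity.
Qed.

Lemma hardy_eval_bound (z : disk) :
  exists M, 0 <= M /\ forall f : hardy w, Cmod (hardy_fun f z) <= M * hardy_norm f.
Proof.
set (Q := Series (fun k => (Cmod (disk_val z) ^ 2) ^ k / beta w k ^ 2)).
assert (Hpos : forall k, 0 <= (Cmod (disk_val z) ^ 2) ^ k / beta w k ^ 2).
{ intros k; apply Rle_mult_inv_pos; [apply pow_le, pow2_ge_0|apply pow_lt, beta_pos]. }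
assert (HQ : 0 <= Q) by (apply Series_ge0; [exact Hpos|apply disk_pow_summable]).
exists ((1 + Q) / 2); split; [lra|intros f].
destruct (Req_dec (hardy_norm f) 0) as [H0|H0].
- rewrite (hardy_norm_eq0 w f H0), hardy_norm_zero.
  simpl hardy_fun; rewrite Cmod_0; lra.
- assert (Hn : 0 < hardy_norm f) by (assert (H := hardy_norm_ge0 w f); lra).
  (* This parameter makes both AM-GM terms linear in the norm: [t / 2 * norm^2 + Q / (2 t) = (1 + Q)
     / 2 * norm]. *)
  set (t := / hardy_norm f); assert (Ht : 0 < t) by (apply Rinv_0_lt_compat, Hn).
  change (norm (hardy_fun f z : C_NormedModule) <= (1 + Q) / 2 * hardy_norm f).
  apply (norm_limit_le (K := C_AbsRing) (V := C_NormedModule) _ _ _ (hardy_taylor f z)).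
  intros n; unfold sum_n at 1.
  apply Rle_trans with (1 := norm_sum_n_m _ _ _).
  apply Rle_trans with (sum_n (fun k => t / 2 * coef_terms w (hardy_coef f) k
       + / (2 * t) * ((Cmod (disk_val z) ^ 2) ^ k / beta w k ^ 2)) n).
  { apply sum_n_m_le; intros k; apply taylor_term_le; exact Ht. }
  apply Rle_trans with (t / 2 * hardy_norm f ^ 2 + / (2 * t) * Q).
  + rewrite hardy_norm_sqr; unfold Q.
    assert (S1 := hardy_summable f); assert (S2 := disk_pow_summable z).
    rewrite <- (Series_scal_l (t / 2)), <- (Series_scal_l (/ (2 * t))).
    rewrite <- Series_plus; try (apply (ex_series_scal_l (V := R_NormedModule)); assumption).
    apply sum_n_le_Series; [|apply ex_series_comb; assumption].
    assert (0 < / (2 * t)) by (apply Rinv_0_lt_compat; lra).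
    intros k; apply Rplus_le_le_0_compat; apply Rmult_le_pos;
      try lra; [apply coef_terms_ge0|apply Hpos].
  + right; unfold t; field; exact H0.
Qed.

Lemma pow_n_RtoC (x : R) (k : nat) : pow_n (K := C_Ring) (RtoC x) k = RtoC (x ^ k).
Proof.
induction k as [|k IH]; [reflexivity|].
change (RtoC x * pow_n (K := C_Ring) (RtoC x) k = RtoC (x * x ^ k))%C.
rewrite IH, RtoC_mult; reflexivity.
Qed.

(** Meant for the real and imaginary parts: at a real point a complex power series splits into two
    real ones. *)
Lemma is_pseries_component (p : C -> R) (a : nat -> C) (x : R) (l : C) :
  (forall u v, p (u + v)%C = p u + p v) ->
  (forall (t : R) u, p (RtoC t * u)%C = t * p u) ->
  (forall u, continuous p u) ->
  is_pseries (V := C_NormedModule) a (RtoC x) l ->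
  is_pseries (fun k => p (a k)) x (p l).
Proof.
intros Hplus Hscal Hcont H.
apply filterlim_ext with
  (fun n => p (sum_n (fun k => scal (pow_n (K := C_Ring) (RtoC x) k) (a k)) n)).
- intros n; induction n as [|n IH].
  + rewrite !sum_O, pow_n_RtoC; apply Hscal.
  + rewrite !sum_Sn, <- IH, pow_n_RtoC, <- pow_n_pow.
    etransitivity; [apply Hplus|]; apply f_equal, Hscal.
- exact (filterlim_comp _ _ _ _ _ _ _ _ H (Hcont l)).
Qed.

Lemma CV_radius_pos (a : nat -> R) : ex_pseries a (1 / 2) -> Rbar_lt 0 (CV_radius a).
Proof.
intros H.
destruct (Rbar_lt_le_dec (CV_radius a) (Rabs (1 / 2))) as [Hlt|Hle].
- exfalso; apply (CV_disk_outside a (1 / 2) Hlt).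
  apply is_lim_seq_ext with (fun n => scal (pow_n (1 / 2) n) (a n)).
  + intros n; rewrite pow_n_pow; unfold scal; simpl; unfold mult; simpl; ring.
  + apply ex_series_lim_0, H.
- apply Rbar_lt_le_trans with (2 := Hle); simpl.
  apply Rabs_pos_lt; lra.
Qed.

(** Values at real points suffice: uniqueness for real power series is applied to both components.
    Operator identities can then be checked pointwise on the disk. *)
Lemma hardy_fun_inj (f g : hardy w) :
  (forall z, hardy_fun f z = hardy_fun g z) -> f = g.
Proof.
intros H; apply hardy_eq; intros k.
assert (Hp : forall p : C -> R,
  (forall u v, p (u + v)%C = p u + p v) ->
  (forall (t : R) u, p (RtoC t * u)%C = t * p u) ->
  (forall u, continuous p u) -> p (hardy_coef f k) = p (hardy_coef g k)).
{ intros p H1 H2 H3.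
  assert (Hx : forall x : R, Rabs x < 1 -> exists l,
    is_pseries (fun i => p (hardy_coef f i)) x l /\
    is_pseries (fun i => p (hardy_coef g i)) x l).
  { intros x Hx.
    assert (Hd : Cmod (RtoC x) < 1) by (rewrite Cmod_R; exact Hx).
    exists (p (hardy_fun f (exist _ (RtoC x) Hd))).
    split; [|rewrite H]; apply is_pseries_component; try assumption;
      apply (hardy_taylor _ (exist _ (RtoC x) Hd)). }
  apply (PSeries_ext_recip (fun i => p (hardy_coef f i)) (fun i => p (hardy_coef g i))).
  1,2: apply CV_radius_pos; destruct (Hx (1 / 2)) as [l [F G]];
      [rewrite Rabs_pos_eq; lra|exists l; assumption].
  exists (mkposreal 1 Rlt_0_1); intros x Bx.
  assert (Bx' : Rabs x < 1).
  { unfold ball in Bx; simpl in Bx; unfold AbsRing_ball, minus, plus, opp, abs in Bx;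
    simpl in Bx; rewrite Ropp_0, Rplus_0_r in Bx; exact Bx. }
  destruct (Hx x Bx') as [l [F G]].
  rewrite (is_pseries_unique _ _ _ F), (is_pseries_unique _ _ _ G); reflexivity. }
apply injective_projections; apply Hp; simpl; intros; try ring.
- apply continuous_fst.
- apply continuous_snd.
Qed.

(** Fatou's lemma for a finite sum: coefficientwise limits preserve a bound on a partial sum. *)
Lemma sum_coef_terms_lim (x : nat -> nat -> C) (b : nat -> C) (M : R) (K n0 : nat) :
  (forall k, filterlim (fun n => x n k) eventually (locally (b k : C_NormedModule))) ->
  (forall n, (n0 <= n)%nat -> sum_n (coef_terms w (x n)) K <= M) ->
  sum_n (coef_terms w b) K <= M.
Proof.
intros Hx HM.
apply (is_lim_seq_le_loc (fun n => sum_n (coef_terms w (x n)) K) (fun _ => M)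
         (sum_n (coef_terms w b) K) M); [exists n0; exact HM| |apply is_lim_seq_const].
assert (Ht : forall k, is_lim_seq (fun n => coef_terms w (x n) k) (coef_terms w b k)).
{ intros k; unfold coef_terms.
  assert (H : is_lim_seq (fun n => Cmod (x n k)) (Cmod (b k))).
  { exact (filterlim_comp _ _ _ _ _ _ _ _ (Hx k)
             (filterlim_norm (K := C_AbsRing) (V := C_NormedModule) (b k))). }
  apply is_lim_seq_ext with (fun n => Cmod (x n k) * Cmod (x n k) * beta w k ^ 2);
    [intros n; ring|].
  replace (Cmod (b k) ^ 2 * beta w k ^ 2)
    with (Cmod (b k) * Cmod (b k) * beta w k ^ 2) by ring.
  apply is_lim_seq_mult'; [apply is_lim_seq_mult'; exact H|apply is_lim_seq_const]. }
induction K as [|K IH].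
- rewrite sum_O; apply is_lim_seq_ext with (fun n => coef_terms w (x n) 0);
    [intros n; rewrite sum_O; reflexivity|apply Ht].
- rewrite sum_Sn_R.
  apply is_lim_seq_ext with (fun n => sum_n (coef_terms w (x n)) K + coef_terms w (x n) (S K));
    [intros n; rewrite sum_Sn_R; reflexivity|].
  apply is_lim_seq_plus'; [|apply Ht].
  apply IH; intros n Hn.
  apply Rle_trans with (2 := HM n Hn), sum_n_incr; [apply coef_terms_ge0|lia].
Qed.

(** The weighted l^2 argument: by [hardy_coef_le] each coefficient is Cauchy, the Fatou step carries
    the Cauchy bound to the limit sequence [b], and [b = (b - x_n) + x_n] is then summable. *)
Lemma hardy_complete (x : nat -> hardy w) :
  (forall e, 0 < e -> exists n0, forall n p, (n0 <= n)%nat -> (n0 <= p)%nat ->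
      hardy_norm (minus (x n) (x p)) <= e) ->
  exists g : hardy w, forall e, 0 < e -> exists n0, forall n, (n0 <= n)%nat ->
      hardy_norm (minus g (x n)) <= e.
Proof.
intros Hx.
assert (Hlim : forall k, exists l : C,
   filterlim (fun n => hardy_coef (x n) k) eventually (locally (l : C_NormedModule))).
{ intros k.
  apply (filterlim_locally_cauchy (U := C_CompleteNormedModule) (F := eventually)
           (fun n => hardy_coef (x n) k)).
  intros e.
  assert (B := beta_pos w k).
  assert (He : 0 < e / 2 * beta w k) by (apply Rmult_lt_0_compat; [apply is_pos_div_2|exact B]).
  destruct (Hx _ He) as [n0 H0].
  exists (fun n => (n0 <= n)%nat); split; [exists n0; intros n Hn; exact Hn|].
  intros n p Hn Hp.
  apply (norm_compat1 (K := C_AbsRing) (V := C_NormedModule)).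
  change (Cmod (hardy_coef (x p) k - hardy_coef (x n) k)%C < e).
  assert (H := hardy_coef_le (minus (x p) (x n)) k).
  rewrite hardy_coef_minus in H.
  assert (H' := Rle_trans _ _ _ H (H0 p n Hp Hn)).
  apply Rmult_le_reg_r in H'; [|exact B].
  assert (Hpos := cond_pos e); lra. }
set (b := fun k => proj1_sig (constructive_indefinite_description _ (Hlim k))).
assert (Hb : forall k, filterlim (fun n => hardy_coef (x n) k) eventually
                         (locally (b k : C_NormedModule)))
  by (intros k; exact (proj2_sig (constructive_indefinite_description _ (Hlim k)))).
assert (Hsum : forall e, 0 < e -> exists n0, forall p, (n0 <= p)%nat -> forall K,
   sum_n (coef_terms w (fun k => (b k - hardy_coef (x p) k)%C)) K <= e ^ 2).
{ intros e He; destruct (Hx e He) as [n0 H0]; exists n0; intros p Hp K.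
  apply (sum_coef_terms_lim (fun n k => (hardy_coef (x n) k - hardy_coef (x p) k)%C) _ _ _ n0).
  - intros k.
    apply (filterlim_comp_2 (G := locally (b k : C_NormedModule))
             (H := locally (opp (hardy_coef (x p) k) : C_NormedModule))
             (fun n => hardy_coef (x n) k) (fun _ => opp (hardy_coef (x p) k)) plus).
    + apply Hb.
    + apply filterlim_const.
    + apply (filterlim_plus (K := C_AbsRing) (V := C_NormedModule)).
  - intros n Hn.
    apply Rle_trans with (hardy_norm (minus (x n) (x p)) ^ 2).
    + rewrite hardy_norm_sqr.
      rewrite (sum_n_ext _ (coef_terms w (hardy_coef (minus (x n) (x p))))).
      * apply sum_n_le_Series; [apply coef_terms_ge0|apply hardy_summable].
      * intros k; unfold coef_terms; rewrite hardy_coef_minus; reflexivity.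
    + apply pow_incr; split; [apply hardy_norm_ge0|apply H0; assumption]. }
assert (Exb : ex_series (coef_terms w b)).
{ destruct (Hsum 1 Rlt_0_1) as [n0 H0]; specialize (H0 n0 (le_n _)).
  apply ex_series_ext with
    (coef_terms w (fun k => ((b k - hardy_coef (x n0) k) + hardy_coef (x n0) k)%C)).
  - intros k; unfold coef_terms; do 3 f_equal; ring.
  - apply ex_coef_terms_plus; [|apply hardy_summable].
    apply series_bounded with (1 ^ 2); [apply coef_terms_ge0|exact H0]. }
destruct (hardy_of_coef b Exb) as [g Hg].
exists g; intros e He; destruct (Hsum e He) as [n0 H0]; exists n0; intros n Hn.
apply hardy_norm_le; [lra|intros K].
apply Rle_trans with (2 := H0 n Hn K); right.
apply sum_n_ext; intros k; unfold coef_terms; rewrite hardy_coef_minus, Hg; reflexivity.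
Qed.

End Hardy.

(** * Composition with a disk automorphism *)

Lemma pow_n_Cpow (z : C) (k : nat) : pow_n (K := C_Ring) z k = (z ^ k)%C.
Proof. induction k as [|k IH]; [reflexivity|]; rewrite Cpow_S, <- IH; reflexivity. Qed.

Lemma Cmod_lt_1_denominator (r : R) (z : C) : 0 <= r < 1 -> Cmod z < 1 ->
  (1 + RtoC r * z)%C <> 0.
Proof.
intros Hr Hz E.
assert (E' : (RtoC r * z = - RtoC 1)%C).
{ replace (RtoC r * z)%C with ((1 + RtoC r * z) + - RtoC 1)%C by ring.
  rewrite E; ring. }
assert (H : Cmod (RtoC r * z) = 1) by (rewrite E'; apply Cmod_m1).
rewrite Cmod_mult, Cmod_R, Rabs_pos_eq in H by lra.
assert (H0 := Cmod_ge_0 z); nra.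
Qed.

Lemma transl_coef_abs_bound (r : R) (j : nat) : 0 <= r < 1 ->
  exists B q, 0 <= B /\ 0 < q < 1 /\
    forall k, Cmod (RtoC (transl_coef r j k)) <= B * q ^ k.
Proof.
intros Hr; exists ((2 / ((1 + r) / 2 - r)) ^ j), ((1 + r) / 2).
split; [apply pow_le, Rlt_le, Rdiv_lt_0_compat; lra|split; [lra|]].
intros k; rewrite Cmod_R; apply (transl_coef_bound r); lra.
Qed.

(** Convergence comes first, from the geometric bound. The value is then forced: the recursion, read
    as an identity of power series, says [(1 + r z) l = (z + r) L], and the denominator does not
    vanish in the disk. *)
Lemma transl_coef_pseries (r : R) (z : C) (j : nat) : 0 <= r < 1 -> Cmod z < 1 ->
  is_pseries (V := C_NormedModule) (fun k => RtoC (transl_coef r j k)) z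
    (((z + RtoC r) / (1 + RtoC r * z)) ^ j)%C.
Proof.
intros Hr Hz.
assert (Ex : forall i, exists l : C, is_pseries (V := C_NormedModule)
            (fun k => RtoC (transl_coef r i k)) z l).
{ intros i; destruct (transl_coef_abs_bound r i Hr) as [B [q [HB [Hq H]]]].
  apply (ex_series_le (K := C_AbsRing) (V := C_CompleteNormedModule)
    (fun k => scal (pow_n (K := C_Ring) z k) (RtoC (transl_coef r i k)))
    (fun k => B * Cmod z ^ k)).
  - intros k; rewrite pow_n_Cpow.
    change (Cmod (z ^ k * RtoC (transl_coef r i k))%C <= B * Cmod z ^ k).
    rewrite Cmod_mult, Cmod_pow, Rmult_comm.
    apply Rmult_le_compat_r; [apply pow_le, Cmod_ge_0|].
    apply Rle_trans with (1 := H k).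
    rewrite <- (Rmult_1_r B) at 2; apply Rmult_le_compat_l; [exact HB|].
    rewrite <- (pow1 k); apply pow_incr; lra.
  - apply (ex_series_scal_l (V := R_NormedModule)), ex_series_geom.
    rewrite Rabs_pos_eq; [exact Hz|apply Cmod_ge_0]. }
assert (Hden := Cmod_lt_1_denominator r z Hr Hz).
induction j as [|j IH].
- destruct (Ex 0%nat) as [l Hl].
  replace (_ ^ 0)%C with (RtoC 1) by reflexivity.
  apply (filterlim_ext (fun _ => RtoC 1)); [|apply filterlim_const].
  intros n; induction n as [|n IHn].
  + rewrite sum_O; symmetry; apply (Cmult_1_l 1).
  + rewrite sum_Sn, <- IHn.
    change (RtoC 1 = 1 + pow_n (K := C_Ring) z (S n) * 0)%C; ring.
- destruct (Ex (S j)) as [l Hl].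
  set (L := (((z + RtoC r) / (1 + RtoC r * z)) ^ j)%C) in *.
  assert (E : (l + RtoC r * (z * l) = z * L + RtoC r * L)%C).
  { assert (H1 := is_pseries_plus _ _ _ _ _ Hl
        (is_pseries_scal (K := C_AbsRing) (V := C_NormedModule) (RtoC r) _ _ _
          (Cmult_comm _ _) (is_pseries_incr_1 _ _ _ Hl))).
    assert (H2 := is_pseries_plus _ _ _ _ _ (is_pseries_incr_1 _ _ _ IH)
        (is_pseries_scal (K := C_AbsRing) (V := C_NormedModule) (RtoC r) _ _ _
          (Cmult_comm _ _) IH)).
    refine (filterlim_locally_unique _ _ _ (is_pseries_ext _ _ _ _ _ H1) H2).
    intros [|k]; unfold PS_plus, PS_scal, PS_incr_1.
    - change (RtoC (r * transl_coef r j 0) + RtoC r * 0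
              = 0 + RtoC r * RtoC (transl_coef r j 0))%C.
      rewrite RtoC_mult; ring.
    - change (RtoC (transl_coef r j k + r * transl_coef r j (S k) - r * transl_coef r (S j) k)
                + RtoC r * RtoC (transl_coef r (S j) k)
              = RtoC (transl_coef r j k) + RtoC r * RtoC (transl_coef r j (S k)))%C.
      rewrite RtoC_minus, RtoC_plus, !RtoC_mult; ring. }
  rewrite Cpow_S; fold L.
  replace (_ / _ * L)%C with l; [exact Hl|].
  replace l with ((l + RtoC r * (z * l)) / (1 + RtoC r * z))%C by (field; exact Hden).
  rewrite E; field; exact Hden.
Qed.

Lemma Cmod_exp_i (t : R) : Cmod (cos t, sin t) = 1.
Proof.
unfold Cmod; simpl fst; simpl snd.
replace (cos t ^ 2 + sin t ^ 2) with 1; [apply sqrt_1|].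
rewrite <- (sin2_cos2 t); unfold Rsqr; ring.
Qed.

Lemma polar_form (z : C) : exists o : C, Cmod o = 1 /\ z = (RtoC (Cmod z) * o)%C.
Proof.
destruct (Req_dec (Cmod z) 0) as [H|H].
- exists (RtoC 1); rewrite Cmod_1; split; [reflexivity|].
  rewrite (Cmod_eq_0 z H), Cmod_0; ring.
- assert (H' : RtoC (Cmod z) <> 0) by (intros E; apply H; exact (RtoC_inj _ _ E)).
  exists (z / RtoC (Cmod z))%C; split.
  + rewrite Cmod_div, Cmod_R, Rabs_pos_eq by (exact H' || apply Cmod_ge_0).
    field; exact H.
  + field; exact H'.
Qed.

(** Write [z0 = r o] with [|o| = 1]. Then [z0 - z = o (r - conj(o) z)] and
    [1 - conj(z0) z = 1 + r (- conj(o) z)], so [u = e^(i theta) o] and [v = - conj(o)]. *)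
Lemma moebius_factor (theta : R) (z0 : C) :
  exists u v : C, Cmod u = 1 /\ Cmod v = 1 /\ forall z,
    moebius theta z0 z
    = (u * ((v * z + RtoC (Cmod z0)) / (1 + RtoC (Cmod z0) * (v * z))))%C.
Proof.
destruct (polar_form z0) as [o [Ho E]].
set (r := Cmod z0) in *.
exists ((cos theta, sin theta) * o)%C, (- Cconj o)%C.
rewrite Cmod_mult, Cmod_opp, Cmod_conj, Cmod_exp_i, Ho.
split; [ring|split; [reflexivity|intros z]].
assert (Hoo : (o * Cconj o = 1)%C) by (rewrite <- Cmod2_conj, Ho, pow1; reflexivity).
unfold moebius, Cdiv; set (e := (cos theta, sin theta) : C).
replace (1 - Cconj z0 * z)%C with (1 + RtoC r * (- Cconj o * z))%C.
- replace (z0 - z)%C with (o * (- Cconj o * z + RtoC r))%C; [ring|].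
  replace (o * (- Cconj o * z + RtoC r))%C
    with (RtoC r * o - (o * Cconj o) * z)%C by ring.
  rewrite Hoo, <- E; ring.
- assert (Hr : Cconj (RtoC r) = RtoC r) by (apply injective_projections; simpl; ring).
  rewrite E, Cmult_conj, Hr; ring.
Qed.

(** * Composition on monomials, on polynomials and on the whole space *)

Section Composition.

Variables (w : weight) (e : nat).
Hypothesis beta_growth : forall k,
  Rabs (beta w k ^ 2 * (INR k + 1) - beta w (S k) ^ 2 * INR k)
    <= INR (2 * e) * beta w k ^ 2 /\
  Rabs (beta w k ^ 2 * (INR k + 1) - beta w (S k) ^ 2 * INR k)
    <= INR (2 * e) * beta w (S k) ^ 2.

Variables (r : R) (u v : C) (phi : disk -> disk).
Hypotheses (r_lt_1 : 0 <= r < 1) (u_unit : Cmod u = 1) (v_unit : Cmod v = 1).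
Hypothesis phi_eq : forall z : disk,
  disk_val (phi z)
  = (u * ((v * disk_val z + RtoC r) / (1 + RtoC r * (v * disk_val z))))%C.

Lemma monomial_comp (j : nat) : exists h : hardy w,
  (forall z, hardy_fun h z = (disk_val (phi z) ^ j)%C) /\
  (forall k, hardy_coef h k = (v ^ k * (u ^ j * RtoC (transl_coef r j k)))%C).
Proof.
assert (Hunit : forall k, Cmod (v ^ k * (u ^ j * RtoC (transl_coef r j k)))
                          = Cmod (RtoC (transl_coef r j k))).
{ intros k; rewrite !Cmod_mult, !Cmod_pow, u_unit, v_unit, !pow1; ring. }
assert (Hs : ex_series (coef_terms w
               (fun k => (v ^ k * (u ^ j * RtoC (transl_coef r j k)))%C))).
{ destruct (transl_coef_abs_bound r j r_lt_1) as [B [q [HB [Hq H]]]].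
  apply (ex_series_le (K := R_AbsRing) (V := R_CompleteNormedModule) _
           (fun k => B ^ 2 * (beta w k ^ 2 * (INR k + 1) * q ^ k))).
  - intros k; change (Rabs (coef_terms w (fun k =>
        (v ^ k * (u ^ j * RtoC (transl_coef r j k)))%C) k)
      <= B ^ 2 * (beta w k ^ 2 * (INR k + 1) * q ^ k)).
    rewrite Rabs_pos_eq by apply coef_terms_ge0.
    unfold coef_terms; rewrite Hunit.
    assert (Hk := pos_INR k); assert (Hb := pow2_ge_0 (beta w k)).
    assert (Hqk : 0 < q ^ k <= 1).
    { split; [apply pow_lt; lra|rewrite <- (pow1 k); apply pow_incr; lra]. }
    assert (H1 : Cmod (RtoC (transl_coef r j k)) ^ 2 <= (B * q ^ k) ^ 2)
      by (apply pow_incr; split; [apply Cmod_ge_0|apply H]).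
    apply Rle_trans with ((B * q ^ k) ^ 2 * beta w k ^ 2);
      [apply Rmult_le_compat_r; assumption|].
    (* One factor [q ^ k] is traded for [INR k + 1], to reach the series already known to
       converge. *)
    assert (H2 : q ^ k * q ^ k <= (INR k + 1) * q ^ k)
      by (apply Rmult_le_compat_r; lra).
    assert (H3 : 0 <= B ^ 2 * beta w k ^ 2) by (apply Rmult_le_pos; [apply pow2_ge_0|exact Hb]).
    assert (H4 := Rmult_le_compat_l _ _ _ H3 H2); lra.
  - apply (ex_series_scal_l (V := R_NormedModule)), sqr_beta_pow_summable; exact Hq. }
unshelve eexists (Hardy w (fun z => (disk_val (phi z) ^ j)%C)
   (fun k => (v ^ k * (u ^ j * RtoC (transl_coef r j k)))%C) _ Hs).
2: split; reflexivity.
intros z; cbv beta; rewrite phi_eq, Cpow_mult_l.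
assert (Hvz : Cmod (v * disk_val z) < 1).
{ rewrite Cmod_mult, v_unit, Rmult_1_l; exact (proj2_sig z). }
assert (H := is_pseries_scal (K := C_AbsRing) (V := C_NormedModule) (u ^ j)%C _ _ _
   (Cmult_comm _ _) (transl_coef_pseries r _ j r_lt_1 Hvz)).
refine (is_series_ext _ _ _ _ H).
intros k; rewrite !pow_n_Cpow, Cpow_mult_l; unfold PS_scal.
change ((v ^ k * disk_val z ^ k) * (u ^ j * RtoC (transl_coef r j k))
  = disk_val z ^ k * (v ^ k * (u ^ j * RtoC (transl_coef r j k))))%C; ring.
Qed.

Definition monomial_comp_fun (j : nat) : hardy w :=
  proj1_sig (constructive_indefinite_description _ (monomial_comp j)).

Lemma monomial_comp_fun_spec (j : nat) :
  (forall z, hardy_fun (monomial_comp_fun j) z = (disk_val (phi z) ^ j)%C) /\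
  (forall k, hardy_coef (monomial_comp_fun j) k
             = (v ^ k * (u ^ j * RtoC (transl_coef r j k)))%C).
Proof. exact (proj2_sig (constructive_indefinite_description _ (monomial_comp j))). Qed.

Definition poly_comp (a : nat -> C) (J : nat) : hardy w :=
  sum_n (fun j => scal (a j : C_Ring) (monomial_comp_fun j)) J.

Lemma poly_comp_fun (a : nat -> C) (J : nat) (z : disk) :
  hardy_fun (poly_comp a J) z
  = sum_n (fun j => scal (pow_n (K := C_Ring) (disk_val (phi z)) j) (a j : C_NormedModule)) J.
Proof.
unfold poly_comp; induction J as [|J IH].
- rewrite !sum_O.
  change (a 0%nat * hardy_fun (monomial_comp_fun 0) z
          = pow_n (K := C_Ring) (disk_val (phi z)) 0 * a 0%nat)%C.
  rewrite (proj1 (monomial_comp_fun_spec 0)); apply Cmult_comm.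
- rewrite !sum_Sn, <- IH.
  change (hardy_fun (poly_comp a J) z + a (S J) * hardy_fun (monomial_comp_fun (S J)) z
    = hardy_fun (poly_comp a J) z + pow_n (K := C_Ring) (disk_val (phi z)) (S J) * a (S J))%C.
  rewrite (proj1 (monomial_comp_fun_spec (S J))), <- pow_n_Cpow.
  f_equal; apply Cmult_comm.
Qed.

(** As [transl_coef r j k] is real, the real and imaginary parts of [u^j a_j] are transported
    separately, each by the real [transl_poly]. *)
Lemma poly_comp_coef (a : nat -> C) (J k : nat) :
  hardy_coef (poly_comp a J) k
  = (v ^ k * (transl_poly (fun j => Re (u ^ j * a j)%C) J r k,
              transl_poly (fun j => Im (u ^ j * a j)%C) J r k))%C.
Proof.
unfold poly_comp, transl_poly; induction J as [|J IH].
- rewrite !sum_O.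
  change (hardy_coef _ k) with (a 0%nat * hardy_coef (monomial_comp_fun 0) k)%C.
  rewrite (proj2 (monomial_comp_fun_spec 0)).
  apply injective_projections; simpl; ring.
- rewrite !sum_Sn.
  change (hardy_coef _ k) with
    (hardy_coef (poly_comp a J) k + a (S J) * hardy_coef (monomial_comp_fun (S J)) k)%C.
  unfold poly_comp; rewrite IH, (proj2 (monomial_comp_fun_spec (S J))).
  set (p := (u ^ S J)%C); set (c := transl_coef r (S J) k); set (b := a (S J)).
  set (x := sum_n _ J); set (y := sum_n _ J).
  clearbody x y p c b.
  change (plus x (Re (p * b)%C * c)) with (x + Re (p * b)%C * c).
  change (plus y (Im (p * b)%C * c)) with (y + Im (p * b)%C * c).
  apply injective_projections; simpl; ring.
Qed.

(** The energies of the two components add up to the squared norm, the unimodular [u^j] and [v^k]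
    being invisible to it. The energy exponent [2 * e] thus becomes [e] for the norm. *)
Lemma poly_comp_norm (a : nat -> C) (J : nat) (M : R) : 0 <= M ->
  sum_n (coef_terms w a) J <= M ^ 2 ->
  hardy_norm (poly_comp a J) <= ((1 + r) / (1 - r)) ^ e * M.
Proof.
intros HM Ha.
assert (HL : 0 <= (1 + r) / (1 - r)) by (apply Rle_mult_inv_pos; lra).
apply hardy_norm_le; [apply Rmult_le_pos; [apply pow_le; exact HL|exact HM]|].
intros K.
set (x := fun j => Re (u ^ j * a j)%C); set (y := fun j => Im (u ^ j * a j)%C).
set (W := fun k => beta w k ^ 2).
assert (HW : forall k, 0 <= W k) by (intros k; apply pow2_ge_0).
assert (Hdecay : forall q, 0 < q < 1 -> is_lim_seq (fun k => W k * (INR k + 1) * q ^ k) 0).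
{ intros q Hq; apply ex_series_lim_0, sqr_beta_pow_summable; exact Hq. }
assert (Hsum : forall n (F G H : nat -> R), (forall k, F k = G k + H k) ->
          sum_n F n = sum_n G n + sum_n H n).
{ intros n F G H E; rewrite (sum_n_ext _ _ n E); apply (sum_n_plus G H n). }
rewrite (Hsum K _ (fun k => W k * transl_poly x J r k ^ 2)
                  (fun k => W k * transl_poly y J r k ^ 2)).
- assert (Hx := energy_le W HW x J (2 * e) beta_growth Hdecay r K r_lt_1).
  assert (Hy := energy_le W HW y J (2 * e) beta_growth Hdecay r K r_lt_1).
  unfold energy in Hx, Hy.
  apply Rle_trans with (1 := Rplus_le_compat _ _ _ _ Hx Hy).
  rewrite <- Rmult_plus_distr_l, Rpow_mult_distr, <- pow_mult, (Nat.mul_comm e 2).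
  apply Rmult_le_compat_l; [apply pow_le; exact HL|].
  apply Rle_trans with (2 := Ha); right; symmetry; apply Hsum.
  intros j; unfold coef_terms, W, x, y.
  rewrite <- Rmult_plus_distr_l, <- Cmod2_alt, Cmod_mult, Cmod_pow, u_unit, pow1; ring.
- intros k; unfold coef_terms; rewrite poly_comp_coef; fold x y.
  rewrite Cmod_mult, Cmod_pow, v_unit, pow1, Rmult_1_l, Cmod2_alt; unfold W; simpl; ring.
Qed.

(** Presents the difference of two truncations as the image of a polynomial, so that
    [poly_comp_norm] bounds it by a tail of the coefficients. *)
Lemma poly_comp_minus (a : nat -> C) (p n : nat) : (p <= n)%nat ->
  minus (poly_comp a n) (poly_comp a p)
  = poly_comp (fun j => if Nat.leb j p then RtoC 0 else a j) n.
Proof.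
intros H; induction H as [|n Hn IH].
- rewrite minus_eq_zero; unfold poly_comp.
  rewrite (sum_n_ext_loc _ (fun _ => zero)).
  + symmetry; apply (sum_n_m_const_zero (G := hardy_AbelianMonoid w)).
  + intros j Hj; rewrite (proj2 (Nat.leb_le j p)) by exact Hj.
    apply (scal_zero_l (V := hardy_ModuleSpace w)).
- unfold poly_comp in *; rewrite !sum_Sn, <- IH, (proj2 (Nat.leb_gt (S n) p)) by lia.
  unfold minus; rewrite <- !plus_assoc; f_equal; apply plus_comm.
Qed.

Lemma sum_coef_terms_tail (a : nat -> C) (p n : nat) : (p <= n)%nat ->
  sum_n (coef_terms w (fun j => if Nat.leb j p then RtoC 0 else a j)) n
  = sum_n (coef_terms w a) n - sum_n (coef_terms w a) p.
Proof.
intros H; induction H as [|n Hn IH].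
- rewrite (sum_n_ext_loc _ (fun _ => zero)).
  + rewrite Rminus_diag; apply (sum_n_m_const_zero (G := R_AbelianMonoid)).
  + intros j Hj; unfold coef_terms; rewrite (proj2 (Nat.leb_le j p)) by exact Hj.
    rewrite Cmod_0; unfold zero; simpl; ring.
- rewrite !sum_Sn_R, IH.
  replace (coef_terms w (fun j => if Nat.leb j p then RtoC 0 else a j) (S n))
    with (coef_terms w a (S n)); [ring_R|].
  unfold coef_terms; rewrite (proj2 (Nat.leb_gt (S n) p)) by lia; reflexivity.
Qed.

Lemma hardy_norm_minus_sym (f g : hardy w) :
  hardy_norm (minus f g) = hardy_norm (minus g f).
Proof.
rewrite <- (opp_minus (G := hardy_AbelianGroup w)).
change (hardy_norm (hardy_scal w (RtoC (-1)) (minus g f)) = hardy_norm (minus g f)).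
rewrite hardy_norm_scal, Cmod_R, Rabs_left by lra; ring.
Qed.

Lemma hardy_comp (f : hardy w) : exists g : hardy w,
  (forall z, hardy_fun g z = hardy_fun f (phi z)) /\
  hardy_norm g <= ((1 + r) / (1 - r)) ^ e * hardy_norm f.
Proof.
set (rho := ((1 + r) / (1 - r)) ^ e).
assert (Hrho : 0 < rho) by (apply pow_lt, Rdiv_lt_0_compat; lra).
set (x := poly_comp (hardy_coef f)).
assert (Hpart : forall n, sum_n (coef_terms w (hardy_coef f)) n <= hardy_norm f ^ 2).
{ intros n; rewrite hardy_norm_sqr.
  apply sum_n_le_Series; [apply coef_terms_ge0|apply hardy_summable]. }
destruct (hardy_complete w x) as [g Hg].
{ intros d Hd.
  (* A tail of squares below [(d / rho)^2] leaves [d] after the factor [rho] of [poly_comp_norm]. *)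
  assert (He : 0 < (d / rho) ^ 2) by (apply pow_lt, Rdiv_lt_0_compat; assumption).
  assert (Hser : is_lim_seq (sum_n (coef_terms w (hardy_coef f))) (hardy_norm f ^ 2))
    by (rewrite hardy_norm_sqr; exact (Series_correct _ (hardy_summable f))).
  apply is_lim_seq_spec in Hser.
  destruct (Hser (mkposreal _ He)) as [n0 H0]; simpl in H0.
  assert (Hle : forall n p, (n0 <= p)%nat -> (p <= n)%nat -> hardy_norm (minus (x n) (x p)) <= d).
  { intros n p Hp Hn; unfold x; rewrite poly_comp_minus by exact Hn.
    replace d with (rho * (d / rho)) by (field; lra).
    apply poly_comp_norm; [left; apply Rdiv_lt_0_compat; assumption|].
    rewrite sum_coef_terms_tail by exact Hn.
    assert (H1 := Hpart n); assert (H2 := Rabs_def2 _ _ (H0 p Hp)); simpl in *; lra. }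
  exists n0; intros n p Hn Hp.
  destruct (Nat.le_ge_cases p n) as [H|H]; [|rewrite hardy_norm_minus_sym]; apply Hle; assumption. }
exists g; split.
- intros z; destruct (hardy_eval_bound w z) as [M [HM HMf]].
  (* The values at [z] of the approximants have two limits: [hardy_fun g z] by bounded evaluation,
     and [hardy_fun f (phi z)] by the Taylor series of [f] at [phi z]. *)
  refine (filterlim_locally_unique (K := C_AbsRing) (V := C_NormedModule) (F := eventually)
            (fun n => hardy_fun (x n) z) _ _ _ _).
  + apply (filterlim_locally_ball_norm (K := C_AbsRing) (U := C_NormedModule)).
    intros d; destruct (Hg (d / (2 * (M + 1)))) as [n0 H0].
    { apply Rdiv_lt_0_compat; [apply cond_pos|lra]. }
    exists n0; intros n Hn; unfold ball_norm.
    change (Cmod (hardy_fun (x n) z - hardy_fun g z)%C < d).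
    rewrite <- hardy_fun_minus.
    apply Rle_lt_trans with (1 := HMf _).
    rewrite hardy_norm_minus_sym.
    apply Rle_lt_trans with (M * (d / (2 * (M + 1)))).
    { apply Rmult_le_compat_l; [exact HM|apply H0; exact Hn]. }
    assert (Hd := cond_pos d).
    replace (M * (d / (2 * (M + 1)))) with (d * (M / (2 * (M + 1)))) by (field; lra).
    rewrite <- (Rmult_1_r d) at 2; apply Rmult_lt_compat_l; [exact Hd|].
    apply Rmult_lt_reg_r with (2 * (M + 1)); [lra|].
    unfold Rdiv; rewrite Rmult_assoc, Rinv_l; lra.
  + apply (filterlim_ext _ _ (fun n => eq_sym (poly_comp_fun (hardy_coef f) n z))).
    apply hardy_taylor.
- apply le_epsilon; intros d Hd; destruct (Hg d Hd) as [n0 H0].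
  specialize (H0 n0 (le_n _)).
  assert (Ht := hardy_norm_triangle w (minus g (x n0)) (x n0)).
  change (hardy_plus w (minus g (x n0)) (x n0)) with (plus (minus g (x n0)) (x n0)) in Ht.
  unfold minus in Ht; rewrite <- plus_assoc, plus_opp_l, plus_zero_r in Ht.
  assert (Hx := poly_comp_norm (hardy_coef f) n0 _ (hardy_norm_ge0 w f) (Hpart n0)).
  fold x rho in Hx; unfold minus in H0; lra.
Qed.

End Composition.

(** * Inverse automorphisms and the spectrum *)

Lemma one_minus_neq_0 (x : C) : Cmod x < 1 -> (1 - x)%C <> 0.
Proof.
intros Hx E.
assert (H : x = RtoC 1) by (replace x with (1 - (1 - x))%C by ring; rewrite E; ring).
rewrite H, Cmod_1 in Hx; lra.
Qed.

Lemma Cmod_conj_mult_lt_1 (x y : C) : Cmod x < 1 -> Cmod y < 1 -> Cmod (Cconj x * y) < 1.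
Proof.
intros Hx Hy; rewrite Cmod_mult, Cmod_conj.
assert (H0 := Cmod_ge_0 x); assert (H1 := Cmod_ge_0 y); nra.
Qed.

(** Rests on [|1 - conj(z0) z|^2 - |z0 - z|^2 = (1 - |z0|^2) (1 - |z|^2)]. *)
Lemma moebius_disk (theta : R) (z0 z : C) :
  Cmod z0 < 1 -> Cmod z < 1 -> Cmod (moebius theta z0 z) < 1.
Proof.
intros H0 Hz; unfold moebius.
assert (Hd := one_minus_neq_0 _ (Cmod_conj_mult_lt_1 _ _ H0 Hz)).
rewrite Cmod_mult, Cmod_exp_i, Rmult_1_l, Cmod_div by exact Hd.
apply Cmod_gt_0 in Hd.
apply Rmult_lt_reg_r with (1 := Hd).
unfold Rdiv; rewrite Rmult_assoc, Rinv_l, Rmult_1_r, Rmult_1_l by lra.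
assert (Hsq : forall x : C, Cmod x < 1 -> 0 < 1 - (Re x ^ 2 + Im x ^ 2)).
{ intros x Hx; rewrite <- Cmod2_alt; assert (H := Cmod_ge_0 x); nra. }
apply Rsqr_incrst_0; try apply Cmod_ge_0.
rewrite !Rsqr_pow2, !Cmod2_alt.
assert (H := Rmult_lt_0_compat _ _ (Hsq _ H0) (Hsq _ Hz)).
destruct z0 as [a b], z as [x y]; simpl in *; nra.
Qed.

Lemma exp_i_opp (t : R) : ((cos t, sin t) * (cos (- t), sin (- t)) = 1)%C.
Proof.
rewrite cos_neg, sin_neg.
apply injective_projections; simpl; [|ring].
rewrite <- (sin2_cos2 t); unfold Rsqr; ring.
Qed.

(** The map [z -> (z0 - z) / (1 - conj(z0) z)] is an involution; moving the rotation to its other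
    side replaces [theta] by [- theta] and [z0] by [e^(i theta) z0]. *)
Lemma moebius_inverse (theta : R) (z0 z : C) : Cmod z0 < 1 -> Cmod z < 1 ->
  moebius (- theta) ((cos theta, sin theta) * z0)%C (moebius theta z0 z) = z.
Proof.
intros H0 Hz; unfold moebius; rewrite Cmult_conj.
assert (Hc : Cconj (cos theta, sin theta) = (cos (- theta), sin (- theta)))
  by (rewrite cos_neg, sin_neg; reflexivity).
assert (Hd := one_minus_neq_0 _ (Cmod_conj_mult_lt_1 _ _ H0 Hz)).
assert (Hd0 := one_minus_neq_0 _ (Cmod_conj_mult_lt_1 _ _ H0 H0)).
rewrite Hc; assert (He := exp_i_opp theta).
set (e := (cos theta, sin theta) : C) in *.
set (e' := (cos (- theta), sin (- theta)) : C) in *.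
assert (He0 : e <> 0) by (intros E; rewrite E, Cmult_0_l in He; injection He; lra).
replace e' with (/ e)%C by (rewrite <- (Cmult_1_r (/ e)), <- He; field; exact He0).
field; repeat split; try assumption.
replace (1 - Cconj z0 * z - Cconj z0 * (z0 - z))%C with (1 - Cconj z0 * z0)%C by ring.
exact Hd0.
Qed.

Lemma composition_operator (N : nat) (w : weight) (theta : R) (z0 : C) (phi : disk -> disk) :
  polynomial_growth N w -> Cmod z0 < 1 ->
  (forall z, disk_val (phi z) = moebius theta z0 (disk_val z)) ->
  exists T : hardy w -> hardy w,
    is_linear T /\ is_composition_operator phi T /\
    forall f, hardy_norm (T f)
      <= ((1 + Cmod z0) / (1 - Cmod z0)) ^ (2 * N ^ 2 + 3 * N + 2) * hardy_norm f.
Proof.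
intros Hw H0 Hphi.
set (e := (2 * N ^ 2 + 3 * N + 2)%nat).
assert (Hr : 0 <= Cmod z0 < 1) by (split; [apply Cmod_ge_0|exact H0]).
destruct (moebius_factor theta z0) as [u [v [Hu [Hv E]]]].
(* The growth constant is enlarged to [2 * e] here, so the energy estimate yields the exponent of
   the theorem at once. *)
assert (Hc : (INR N + 1) ^ 2 <= INR (2 * e)).
{ rewrite <- S_INR, <- pow_INR; apply le_INR; unfold e; simpl; lia. }
assert (Hgrowth : forall k,
  Rabs (beta w k ^ 2 * (INR k + 1) - beta w (S k) ^ 2 * INR k)
    <= INR (2 * e) * beta w k ^ 2 /\
  Rabs (beta w k ^ 2 * (INR k + 1) - beta w (S k) ^ 2 * INR k)
    <= INR (2 * e) * beta w (S k) ^ 2).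
{ intros k; destruct (sqr_beta_growth N w Hw k) as [G1 G2].
  split; [apply Rle_trans with (1 := G1)|apply Rle_trans with (1 := G2)];
    apply Rmult_le_compat_r; try exact Hc; apply pow2_ge_0. }
assert (Hex := hardy_comp w e Hgrowth (Cmod z0) u v phi Hr Hu Hv
                 (fun z => eq_trans (Hphi z) (E (disk_val z)))).
set (T := fun f => proj1_sig (constructive_indefinite_description _ (Hex f))).
assert (HT : forall f, (forall z, hardy_fun (T f) z = hardy_fun f (phi z)) /\
   hardy_norm (T f) <= ((1 + Cmod z0) / (1 - Cmod z0)) ^ e * hardy_norm f)
  by (intros f; exact (proj2_sig (constructive_indefinite_description _ (Hex f)))).
exists T; split; [|split; [exact (fun f => proj1 (HT f))|exact (fun f => proj2 (HT f))]].
split.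
- intros f g; apply hardy_fun_inj; intros z.
  rewrite (proj1 (HT _)).
  change (hardy_fun f (phi z) + hardy_fun g (phi z)
          = hardy_fun (T f) z + hardy_fun (T g) z)%C.
  rewrite !(proj1 (HT _)); reflexivity.
- intros c f; apply hardy_fun_inj; intros z.
  rewrite (proj1 (HT _)).
  change (c * hardy_fun f (phi z) = c * hardy_fun (T f) z)%C.
  rewrite (proj1 (HT _)); reflexivity.
- exists (((1 + Cmod z0) / (1 - Cmod z0)) ^ e); split.
  + apply pow_lt, Rdiv_lt_0_compat; lra.
  + intros f; apply (HT f).
Qed.

(** * Neumann series and the spectral annulus *)

Section Resolvent.

Variable w : weight.

Lemma hardy_coef_plus (f g : hardy w) k :
  hardy_coef (plus f g) k = (hardy_coef f k + hardy_coef g k)%C.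
Proof. reflexivity. Qed.

Lemma hardy_coef_scal (c : C) (f : hardy w) k :
  hardy_coef (scal (c : C_Ring) f) k = (c * hardy_coef f k)%C.
Proof. reflexivity. Qed.

Lemma hardy_linear_minus (A : hardy w -> hardy w) : is_linear A ->
  forall f g, A (minus f g) = minus (A f) (A g).
Proof.
intros HA f g.
change (A (plus f (scal (RtoC (-1) : C_Ring) g))
        = plus (A f) (scal (RtoC (-1) : C_Ring) (A g))).
rewrite (linear_plus A HA), (linear_scal A HA); reflexivity.
Qed.

Lemma hardy_norm_minus_ge (f g : hardy w) :
  hardy_norm f - hardy_norm g <= hardy_norm (minus f g).
Proof.
assert (H := hardy_norm_triangle w (minus f g) g).
replace (hardy_plus w (minus f g) g) with f in H; [lra|].
apply hardy_eq; intros k.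
change (hardy_coef f k = hardy_coef (minus f g) k + hardy_coef g k)%C.
rewrite hardy_coef_minus; ring.
Qed.

(** The iterates [X n] are the partial sums of [sum A^i y]. *)
Lemma neumann_surjective (A : hardy w -> hardy w) (q : R) : 0 <= q < 1 ->
  is_linear A -> (forall f, hardy_norm (A f) <= q * hardy_norm f) ->
  forall y, exists x, minus x (A x) = y.
Proof.
intros Hq HA Hbound y.
set (X := fix X n : hardy w := match n with O => zero | S n' => plus y (A (X n')) end).
set (M := hardy_norm y / (1 - q)).
assert (HX : forall n, hardy_norm (X n) <= M).
{ assert (HM0 : 0 <= M) by (apply Rle_mult_inv_pos; [apply hardy_norm_ge0|lra]).
  induction n as [|n IH].
  - change (hardy_norm (hardy_zero w) <= M); rewrite hardy_norm_zero; exact HM0.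
  - simpl X; apply Rle_trans with (1 := hardy_norm_triangle w y (A (X n))).
    assert (H := Hbound (X n)).
    assert (H1 := Rmult_le_compat_l q _ _ (proj1 Hq) IH).
    replace M with (hardy_norm y + q * M) by (unfold M; field; lra); lra. }
(* The difference [X (n + p) - X n] is [A^n (X p)]. *)
assert (Hdiff : forall p n, hardy_norm (minus (X (n + p)%nat) (X n)) <= q ^ n * M).
{ intros p n; induction n as [|n IH].
  - simpl; rewrite Rmult_1_l.
    apply Rle_trans with (2 := HX p); right; f_equal.
    apply hardy_eq; intros k; rewrite hardy_coef_minus.
    change (hardy_coef (X p) k - 0 = hardy_coef (X p) k)%C; ring.
  - replace (minus (X (S n + p)%nat) (X (S n))) with (A (minus (X (n + p)%nat) (X n))).
    + apply Rle_trans with (1 := Hbound _); simpl pow.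
      rewrite Rmult_assoc; apply Rmult_le_compat_l; [lra|exact IH].
    + rewrite (hardy_linear_minus A HA); apply hardy_eq; intros k.
      simpl plus; simpl X; rewrite !hardy_coef_minus, !hardy_coef_plus; ring. }
destruct (hardy_complete w X) as [g Hg].
{ intros d Hd.
  assert (Hlim : is_lim_seq (fun n => q ^ n * M) 0).
  { replace 0 with (0 * M) by ring.
    apply is_lim_seq_mult'; [|apply is_lim_seq_const].
    apply is_lim_seq_geom; rewrite Rabs_pos_eq; lra. }
  apply is_lim_seq_spec in Hlim; destruct (Hlim (mkposreal d Hd)) as [n0 H0].
  assert (Hle : forall n p, (n0 <= p)%nat -> (p <= n)%nat -> hardy_norm (minus (X n) (X p)) <= d).
  { intros n p Hp Hn; replace n with (p + (n - p))%nat by lia.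
    apply Rle_trans with (1 := Hdiff _ _).
    assert (H := Rabs_def2 _ _ (H0 p Hp)); simpl in H; lra. }
  exists n0; intros n p Hn Hp.
  destruct (Nat.le_ge_cases p n) as [H|H]; [|rewrite hardy_norm_minus_sym]; apply Hle; assumption. }
exists g.
assert (Hz : hardy_norm (minus (minus g (A g)) y) = 0).
{ apply Rle_antisym; [|apply hardy_norm_ge0].
  apply le_epsilon; intros d Hd; rewrite Rplus_0_l.
  destruct (Hg (d / 2)) as [n0 H0]; [lra|].
  (* Since [y = X (S n0) - A (X n0)], the residual of [g] is expressed by two approximation
     errors. *)
  replace (minus (minus g (A g)) y) with
    (plus (minus g (X (S n0))) (A (minus (X n0) g))).
  - apply Rle_trans with (1 := hardy_norm_triangle w _ _).
    assert (H1 := H0 (S n0) ltac:(lia)); assert (H2 := H0 n0 (le_n _)).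
    assert (H3 := Hbound (minus (X n0) g)).
    rewrite (hardy_norm_minus_sym w (X n0) g) in H3.
    assert (H4 := hardy_norm_ge0 w (minus g (X n0))).
    assert (q * hardy_norm (minus g (X n0)) <= 1 * hardy_norm (minus g (X n0)))
      by (apply Rmult_le_compat_r; lra).
    lra.
  - rewrite (hardy_linear_minus A HA); apply hardy_eq; intros k.
    simpl X; rewrite hardy_coef_plus, !hardy_coef_minus, hardy_coef_plus; ring. }
apply hardy_norm_eq0 in Hz; apply hardy_eq; intros k.
assert (H := f_equal (fun f => hardy_coef f k) Hz); cbv beta in H.
rewrite hardy_coef_minus in H.
replace (hardy_coef y k)
  with (hardy_coef y k + (hardy_coef (minus g (A g)) k - hardy_coef y k))%C; [ring|].
rewrite H; simpl; ring.
Qed.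

(** The lower bound gives injectivity, so chosen preimages form a linear two-sided inverse, and it
    bounds that inverse by [/ d]. *)
Lemma not_spectrum (T : hardy w -> hardy w) (lambda : C) (d : R) :
  is_linear T -> 0 < d ->
  (forall x, d * hardy_norm x <= hardy_norm (minus (T x) (scal (lambda : C_AbsRing) x))) ->
  (forall y, exists x, minus (T x) (scal (lambda : C_AbsRing) x) = y) ->
  ~ spectrum T lambda.
Proof.
intros HT Hd Hbelow Hsurj Hspec; apply Hspec; clear Hspec.
set (D := fun x => minus (T x) (scal (lambda : C_AbsRing) x)).
assert (HD : forall x y, D x = D y -> x = y).
{ intros x y E.
  assert (H : D (minus x y) = minus (D x) (D y)).
  { unfold D; rewrite (hardy_linear_minus T HT); apply hardy_eq; intros k.
    rewrite !hardy_coef_minus, !hardy_coef_scal, hardy_coef_minus; ring. }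
  rewrite E, minus_eq_zero in H.
  assert (H1 := Hbelow (minus x y)); fold (D (minus x y)) in H1; rewrite H in H1.
  change (d * hardy_norm (minus x y) <= hardy_norm (hardy_zero w)) in H1.
  rewrite hardy_norm_zero in H1.
  assert (H2 := hardy_norm_ge0 w (minus x y)).
  assert (H3 : hardy_norm (minus x y) = 0) by nra.
  apply hardy_norm_eq0 in H3; apply hardy_eq; intros k.
  assert (H4 := f_equal (fun f => hardy_coef f k) H3); cbv beta in H4.
  rewrite hardy_coef_minus in H4.
  replace (hardy_coef x k) with (hardy_coef y k + (hardy_coef x k - hardy_coef y k))%C by ring.
  rewrite H4; simpl; ring. }
set (S := fun y => proj1_sig (constructive_indefinite_description _ (Hsurj y))).
assert (HS : forall y, D (S y) = y)
  by (intros y; exact (proj2_sig (constructive_indefinite_description _ (Hsurj y)))).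
exists S; split; [split|].
- intros x y; apply HD; rewrite HS.
  rewrite <- (HS x) at 1; rewrite <- (HS y) at 1.
  unfold D; rewrite (linear_plus T HT); apply hardy_eq; intros k.
  rewrite !hardy_coef_plus, !hardy_coef_minus, !hardy_coef_scal, !hardy_coef_plus; ring.
- intros c x; apply HD; rewrite HS.
  rewrite <- (HS x) at 1.
  unfold D; rewrite (linear_scal T HT); apply hardy_eq; intros k.
  change (c * hardy_coef (minus (T (S x)) (scal (lambda : C_AbsRing) (S x))) k
    = hardy_coef (minus (scal c (T (S x))) (scal (lambda : C_AbsRing) (scal c (S x)))) k)%C.
  rewrite !hardy_coef_minus, !hardy_coef_scal; ring.
- exists (/ d); split; [apply Rinv_0_lt_compat, Hd|].
  intros y; change (hardy_norm (S y) <= / d * hardy_norm y).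
  assert (H := Hbelow (S y)); fold (D (S y)) in H; rewrite HS in H.
  apply Rmult_le_reg_l with d; [exact Hd|].
  rewrite <- Rmult_assoc, Rinv_r, Rmult_1_l by lra; exact H.
- intros x; split; [|apply HS].
  apply HD; rewrite HS; reflexivity.
Qed.

Lemma is_linear_scal_comp (c : C) (T : hardy w -> hardy w) : is_linear T ->
  is_linear (fun x => scal (c : C_Ring) (T x) : hardy w).
Proof.
intros HT; split.
- intros x y; rewrite (linear_plus T HT); apply hardy_eq; intros k.
  rewrite hardy_coef_plus, !hardy_coef_scal, hardy_coef_plus; ring.
- intros b x; rewrite (linear_scal T HT); apply hardy_eq; intros k.
  change (c * (b * hardy_coef (T x) k) = b * (c * hardy_coef (T x) k))%C; ring.
- destruct (linear_norm T HT) as [M [HM H]].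
  exists ((Cmod c + 1) * M); assert (Hc := Cmod_ge_0 c); split; [nra|].
  intros x; specialize (H x).
  change (hardy_norm (hardy_scal w c (T x)) <= (Cmod c + 1) * M * hardy_norm x).
  change (hardy_norm (T x) <= M * hardy_norm x) in H.
  rewrite hardy_norm_scal, Rmult_assoc.
  apply Rmult_le_compat; [exact Hc|apply hardy_norm_ge0|lra|exact H].
Qed.

(** Inside the inner circle [T - lambda = T (1 - lambda S)]; outside the outer one
    [T - lambda = - lambda (1 - T / lambda)]. In both cases the bracket is a contraction away from
    the identity. *)
Lemma spectrum_annulus (T S : hardy w -> hardy w) (rho : R) (lambda : C) : 0 < rho ->
  is_linear T -> is_linear S ->
  (forall f, hardy_norm (T f) <= rho * hardy_norm f) ->
  (forall f, hardy_norm (S f) <= rho * hardy_norm f) ->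
  (forall f, T (S f) = f) -> (forall f, S (T f) = f) ->
  spectrum T lambda -> / rho <= Cmod lambda <= rho.
Proof.
intros Hrho HT HS Tle Sle TS ST Hspec.
assert (Hir := Rinv_0_lt_compat _ Hrho).
assert (Hl := Cmod_ge_0 lambda).
split; apply Rnot_lt_le; intros Hlt.
- apply (not_spectrum T lambda (/ rho - Cmod lambda) HT); [lra| | |exact Hspec].
  + intros x; apply Rle_trans with (2 := hardy_norm_minus_ge _ _).
    change (hardy_norm (scal (lambda : C_AbsRing) x)) with (hardy_norm (hardy_scal w lambda x)).
    rewrite hardy_norm_scal.
    assert (H := Sle (T x)); rewrite ST in H.
    apply Rmult_le_compat_l with (r := / rho) in H; [|lra].
    rewrite <- Rmult_assoc, Rinv_l, Rmult_1_l in H by lra; lra.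
  + intros y.
    (* Solving [x - lambda S x = S y] and applying [T] gives [T x - lambda x = y]. *)
    destruct (neumann_surjective (fun x => scal (lambda : C_Ring) (S x)) (Cmod lambda * rho))
      with (y := S y) as [x Hx].
    * split; [apply Rmult_le_pos; lra|].
      rewrite <- (Rinv_l rho) by lra; apply Rmult_lt_compat_r; assumption.
    * apply is_linear_scal_comp, HS.
    * intros f; change (hardy_norm (hardy_scal w lambda (S f)) <= Cmod lambda * rho * hardy_norm f).
      rewrite hardy_norm_scal, Rmult_assoc.
      apply Rmult_le_compat_l; [exact Hl|apply Sle].
    * exists x.
      rewrite <- (TS y), <- Hx, (hardy_linear_minus T HT), (linear_scal T HT), TS.
      reflexivity.
- assert (Hl0 : lambda <> 0) by (apply Cmod_gt_0; lra).
  apply (not_spectrum T lambda (Cmod lambda - rho) HT); [lra| | |exact Hspec].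
  + intros x; rewrite hardy_norm_minus_sym.
    apply Rle_trans with (2 := hardy_norm_minus_ge _ _).
    change (hardy_norm (scal (lambda : C_AbsRing) x)) with (hardy_norm (hardy_scal w lambda x)).
    rewrite hardy_norm_scal; assert (H := Tle x); lra.
  + intros y.
    (* The equation [T x - lambda x = y] divided by [- lambda]. *)
    destruct (neumann_surjective (fun x => scal (/ lambda : C_Ring)%C (T x)) (/ Cmod lambda * rho))
      with (y := scal (- / lambda : C_Ring)%C y) as [x Hx].
    * assert (Hil := Rinv_0_lt_compat (Cmod lambda) ltac:(lra)).
      split; [apply Rmult_le_pos; lra|].
      rewrite <- (Rinv_l (Cmod lambda)) by lra; apply Rmult_lt_compat_l; assumption.
    * apply is_linear_scal_comp, HT.
    * intros f.
      change (hardy_norm (hardy_scal w (/ lambda)%C (T f)) <= / Cmod lambda * rho * hardy_norm f).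
      rewrite hardy_norm_scal, Cmod_inv, Rmult_assoc by exact Hl0.
      apply Rmult_le_compat_l; [left; apply Rinv_0_lt_compat; lra|apply Tle].
    * exists x; apply hardy_eq; intros k.
      assert (H := f_equal (fun f => hardy_coef f k) Hx); cbv beta in H.
      rewrite hardy_coef_minus, !hardy_coef_scal in H.
      rewrite hardy_coef_minus, hardy_coef_scal.
      replace (hardy_coef y k) with (- lambda * (- / lambda * hardy_coef y k))%C
        by (field; exact Hl0).
      rewrite <- H; field; exact Hl0.
Qed.

End Resolvent.

Theorem theorem3p9 (N : nat) (hN : (1 <= N)%nat) (w : weight)
    (hw : polynomial_growth N w) (phi : disk -> disk)
    (hphi : hyperbolic_automorphism phi) :
  exists Cphi : hardy w -> hardy w,
    is_linear Cphi /\
    is_composition_operator phi Cphi /\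
    forall lambda : C, spectrum Cphi lambda ->
      let r := Cmod (disk_val (phi disk_center)) in
      ((1 - r) / (1 + r)) ^ (2 * N ^ 2 + 3 * N + 2) <= Cmod lambda
      <= ((1 + r) / (1 - r)) ^ (2 * N ^ 2 + 3 * N + 2).
Proof.
destruct hphi as [theta [z0 [H0 [Hphi _]]]].
(* The parameter of the inverse automorphism; its modulus is that of [z0], so one bound serves both
   operators. *)
set (z1 := ((cos theta, sin theta) * z0)%C).
assert (H1 : Cmod z1 = Cmod z0) by (unfold z1; rewrite Cmod_mult, Cmod_exp_i; ring).
assert (H1' : Cmod z1 < 1) by (rewrite H1; exact H0).
set (psi := fun z : disk => exist (fun x : C => Cmod x < 1)
   (moebius (- theta) z1 (disk_val z)) (moebius_disk _ _ _ H1' (proj2_sig z)) : disk).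
assert (Hext : forall x y : disk, disk_val x = disk_val y -> x = y).
{ intros [x Hx] [y Hy]; simpl; intros E; subst y; f_equal; apply proof_irrelevance. }
assert (Hpsi_phi : forall z, psi (phi z) = z).
{ intros z; apply Hext; change (moebius (- theta) z1 (disk_val (phi z)) = disk_val z).
  rewrite Hphi; apply moebius_inverse; [exact H0|exact (proj2_sig z)]. }
assert (Hphi_psi : forall z, phi (psi z) = z).
{ intros z; apply Hext; rewrite Hphi.
  change (disk_val (psi z)) with (moebius (- theta) z1 (disk_val z)).
  assert (E := moebius_inverse (- theta) z1 (disk_val z) H1' (proj2_sig z)).
  rewrite Ropp_involutive in E; unfold z1 at 1 in E.
  rewrite Cmult_assoc, (Cmult_comm (cos (- theta), sin (- theta))), exp_i_opp, Cmult_1_l in E.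
  exact E. }
destruct (composition_operator N w theta z0 phi hw H0 Hphi) as [T [HT [HTc HTn]]].
destruct (composition_operator N w (- theta) z1 psi hw H1' (fun z => eq_refl))
  as [S [HS [HSc HSn]]].
rewrite H1 in HSn.
exists T; split; [exact HT|split; [exact HTc|]].
intros lambda Hspec r.
assert (Hr : r = Cmod z0).
{ unfold r; rewrite Hphi; unfold moebius; change (disk_val disk_center) with (RtoC 0).
  rewrite Cmod_mult, Cmod_exp_i, Rmult_1_l; f_equal; field. }
rewrite Hr; clear r Hr; set (r := Cmod z0) in *.
assert (Hr0 : 0 <= r) by apply Cmod_ge_0.
set (e := (2 * N ^ 2 + 3 * N + 2)%nat) in *.
assert (Hrho : 0 < ((1 + r) / (1 - r)) ^ e) by (apply pow_lt, Rdiv_lt_0_compat; lra).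
replace (((1 - r) / (1 + r)) ^ e) with (/ ((1 + r) / (1 - r)) ^ e).
- apply (spectrum_annulus w T S); try assumption.
  (* Composition reverses order: [T (S f)] is [f o psi o phi]. *)
  + intros f; apply hardy_fun_inj; intros z; rewrite HTc, HSc, Hpsi_phi; reflexivity.
  + intros f; apply hardy_fun_inj; intros z; rewrite HSc, HTc, Hphi_psi; reflexivity.
- rewrite <- pow_inv; f_equal; field; lra.
Qed.
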